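(* In the setting of the context, let the precoders be the maximum ratio transmission (MRT) precoders $\bar{\mathbf w}_{si}=\bar{\mathbf g}_{si}$ and $\tilde{\mathbf w}_{sj}=\tilde{\mathbf g}_{sj}$ for all subarrays $s$, near-field users $i\in\mathcal{K_N}$ and far-field users $j\in\mathcal{K_F}$. Then the spectral efficiency $\widetilde{\mathrm{SE}}_k$ of every far-field user $k\in\mathcal{K_F}$ is $\widetilde{\mathrm{SE}}_k=\log_2(1+\widetilde{\mathrm{SINR}}_k)$ with $$\widetilde{\mathrm{SINR}}_k=\frac{P_f\Big(\sum_{s\in\tilde{\mathcal S}_k}\sqrt{\tilde\eta_{sk}}\,\tilde\Psi_k^s\Big)^2}{\tilde\Delta+\sigma_k^2},\qquad \tilde\Psi_k^s=\mathbf h_k^H\boldsymbol\Theta\big(\alpha_2^2\bar{\mathbf H}_{2,s}\bar{\mathbf H}_{2,s}^H+\beta_2^2M^\ast\mathbf I_N\big)\boldsymbol\Theta^H\mathbf h_k,$$ $$\tilde\Delta=P_f\sum_{s\in\tilde{\mathcal S}_k}\tilde\eta_{sk}\tilde a_k^s+P_f\sum_{j\in\mathcal{K_F}\setminus\{k\}}\sum_{s\in\tilde{\mathcal S}_j}\sum_{s'\in\tilde{\mathcal S}_j}\sqrt{\tilde\eta_{sj}\tilde\eta_{s'j}}\,\tilde b_{kj}^{ss'}+P_n\sum_{i\in\mathcal{K_N}}\sum_{s\in\bar{\mathcal S}_i}\sum_{s'\in\bar{\mathcal S}_i}\sqrt{\bar\eta_{si}\bar\eta_{s'i}}\,\bar\Xi_{ki}^{ss'},$$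 where, with $\mathbf M_{jj}=\boldsymbol\Theta^H\mathbf h_j\mathbf h_j^H\boldsymbol\Theta$ for $j\in\mathcal{K_F}$ and $\mathbf b=\mathbf b_N(\varphi^a,\varphi^e)$, $$\bar\Xi_{ki}^{ss'}=\Re\big\{\bar{\mathbf g}_{s'i}^H\mathbf B_{ki}^{ss'}\bar{\mathbf g}_{si}\big\},\qquad \mathbf B_{ki}^{ss'}=\alpha_2^2\bar{\mathbf H}_{2,s'}^H\mathbf M_{kk}\bar{\mathbf H}_{2,s}+\delta_{ss'}\varsigma_k\beta_2^2N\,\mathbf I_{M^\ast},$$ $$\tilde a_k^s=\Re\Big\{\mathbf h_k^H\boldsymbol\Theta\Big(\varsigma_k\alpha_2^2\beta_2^2N\,\bar{\mathbf H}_{2,s}\bar{\mathbf H}_{2,s}^H+\big(\alpha_2^2\beta_2^2M^\ast\,\mathbf b^H\mathbf M_{kk}\mathbf b+\varsigma_k\beta_2^4NM^\ast\big)\mathbf I_N\Big)\boldsymbol\Theta^H\mathbf h_k\Big\},$$ $$\tilde b_{kj}^{ss'}=\Re\Big\{\mathbf h_k^H\boldsymbol\Theta\big(\delta_{ss'}\mathbf C_{sj}+(1-\delta_{ss'})\mathbf D_j^{ss'}\big)\boldsymbol\Theta^H\mathbf h_k\Big\},$$ $$\mathbf D_j^{ss'}=(\alpha_2^2\bar{\mathbf H}_{2,s}\bar{\mathbf H}_{2,s}^H+\beta_2^2M^\ast\mathbf I_N)\,\mathbf M_{jj}\,(\alpha_2^2\bar{\mathbf H}_{2,s'}\bar{\mathbf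 H}_{2,s'}^H+\beta_2^2M^\ast\mathbf I_N),$$ $$\begin{aligned}\mathbf C_{sj}=\;&\alpha_2^4\bar{\mathbf H}_{2,s}\bar{\mathbf H}_{2,s}^H\mathbf M_{jj}\bar{\mathbf H}_{2,s}\bar{\mathbf H}_{2,s}^H+\beta_2^2\Big(\alpha_2^2M^\ast\bar{\mathbf H}_{2,s}\bar{\mathbf H}_{2,s}^H\mathbf M_{jj}+\alpha_2^2\,\mathrm{tr}(\mathbf M_{jj})\bar{\mathbf H}_{2,s}\bar{\mathbf H}_{2,s}^H\\&+\alpha_2^2\,\mathrm{tr}(\bar{\mathbf H}_{2,s}^H\mathbf M_{jj}\bar{\mathbf H}_{2,s})\,\mathbf I_N+\alpha_2^2M^\ast\mathbf M_{jj}\bar{\mathbf H}_{2,s}\bar{\mathbf H}_{2,s}^H+\beta_2^2(M^\ast)^2\mathbf M_{jj}+\beta_2^2M^\ast\,\mathrm{tr}(\mathbf M_{jj})\,\mathbf I_N\Big).\end{aligned}$$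
   Context: Array and users. A base-station planar array has $M=M_xM_y$ antennas ($M_x,M_y$ odd), spacing $d=\lambda/2$, wavelength $\lambda>0$, partitioned into $S$ subarrays of $M^\ast=M/S$ antennas each; subarray $s\in\mathcal S=\{1,\dots,S\}$ consists of the antennas with indices $r_s=\{(s-1)M^\ast+1,\dots,sM^\ast\}$. Near-field users: $\mathcal{K_N}=\{1,\dots,K_n\}$; far-field users: $\mathcal{K_F}=\{1,\dots,K_f\}$. A reconfigurable intelligent surface (RIS) has $N=N_1N_2$ elements and fixed phase matrix $\boldsymbol\Theta=\mathrm{diag}(e^{j\theta_1},\dots,e^{j\theta_N})$, $\theta_n\in[0,2\pi)$ real. Near-field channels (deterministic, line of sight). Antenna $m$ has coordinates $(m_xd,m_yd,0)$ with $m_x=-\frac{M_x-1}{2}+((m-1)\bmod M_x)$, $m_y=\frac{M_y-1}{2}-\lfloor (m-1)/M_x\rfloor$. User $k\in\mathcal{K_N}$ is at $(u_{k,x},u_{k,y},u_{k,z})$, $u_{k,z}>0$. Put $r_{m,k}=\sqrt{(u_{k,x}-m_xd)^2+(u_{k,y}-m_yd)^2+u_{k,z}^2}$, and $\bar g_{m,k}=\sqrt{\frac{A}{4\pi}\frac{u_{k,z}((u_{k,x}-m_xd)^2+u_{k,z}^2)}{r_{m,k}^5}}\;e^{-j2\pi r_{m,k}/\lambda}$ with $A=\lambda^2/(4\pi)$. The channel of subarray $s$ to user $k$ is $\bar{\mathbf g}_{sk}=[\bar g_{m,k}]_{m\in r_s}\in\mathbb C^{M^\ast}$. Far-field channels.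 The array-to-RIS channel is $\mathbf H_2=\alpha_2\bar{\mathbf H}_2+\beta_2\tilde{\mathbf H}_2\in\mathbb C^{N\times M}$, where $\alpha_2=\sqrt{\iota\zeta/(\iota+1)}$, $\beta_2=\sqrt{\zeta/(\iota+1)}$ with $\iota\geq 0,\zeta>0$; $\bar{\mathbf H}_2=\mathbf b_N(\varphi^a,\varphi^e)\mathbf a_M(\phi^a,\phi^e)^H$ is deterministic, and $\tilde{\mathbf H}_2$ has i.i.d. $\mathcal{CN}(0,1)$ (circularly symmetric) entries. Here, with fixed real angles, $\mathbf a_M(\phi^a,\phi^e)=[e^{j2\pi m d\cos\phi^e\sin\phi^a/\lambda}]_{m=0}^{M_x-1}\otimes[e^{j2\pi m d\sin\phi^e/\lambda}]_{m=0}^{M_y-1}$ and $\mathbf b_N(\varphi^a,\varphi^e)=[e^{j2\pi n d_R\cos\varphi^e\sin\varphi^a/\lambda}]_{n=0}^{N_1-1}\otimes[e^{j2\pi n d_R\sin\varphi^e/\lambda}]_{n=0}^{N_2-1}$ (column vectors), $d_R=\lambda/2$. $\mathbf H_{2,s},\bar{\mathbf H}_{2,s}\in\mathbb C^{N\times M^\ast}$ are the submatrices of $\mathbf H_2,\bar{\mathbf H}_2$ with columns $r_s$. The RIS-to-user channel of $k\in\mathcal{K_F}$ is $\mathbf h_k=\sqrt{\varsigma_k}\,\mathbf b_N(\vartheta_k^a,\vartheta_k^e)\in\mathbb C^N$, $\varsigma_k>0$, and the cascaded channel from subarray $s$ is $\tilde{\mathbf g}_{sk}^H=\mathbf h_k^H\boldsymbol\Theta\mathbf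 H_{2,s}$. Visibility regions and powers. $\bar{\mathcal S}_i\subseteq\mathcal S$ ($i\in\mathcal{K_N}$) and $\tilde{\mathcal S}_j\subseteq\mathcal S$ ($j\in\mathcal{K_F}$) are given sets of subarrays serving each user (visibility regions). $P_n,P_f>0$ are powers, $\bar\eta_{si},\tilde\eta_{sj}\ge0$ are power-control coefficients, $\sigma_k^2>0$ is the noise power. Spectral efficiency of far-field user $k$ for given precoders $\bar{\mathbf w}_{si},\tilde{\mathbf w}_{sj}\in\mathbb C^{M^\ast}$: by definition $\widetilde{\mathrm{SE}}_k=\log_2(1+\widetilde{\mathrm{SINR}}_k)$, where $$\widetilde{\mathrm{SINR}}_k=\frac{|\widetilde{\mathrm{DS}}_k|^2}{\mathbb E\{|\widetilde{\mathrm{BU}}_k|^2\}+\sum_{j\in\mathcal{K_F}\setminus\{k\}}\mathbb E\{|\widetilde{\mathrm{UI}}^{\mathrm F}_j|^2\}+\sum_{i\in\mathcal{K_N}}\mathbb E\{|\widetilde{\mathrm{UI}}^{\mathrm N}_i|^2\}+\sigma_k^2},$$ with $X_k=\sum_{s\in\tilde{\mathcal S}_k}\sqrt{\tilde\eta_{sk}}\tilde{\mathbf g}_{sk}^H\tilde{\mathbf w}_{sk}$, $\widetilde{\mathrm{DS}}_k=\sqrt{P_f}\,\mathbb E\{X_k\}$, $\widetilde{\mathrm{BU}}_k=\sqrt{P_f}(X_k-\mathbb E\{X_k\})$, $\widetilde{\mathrm{UI}}^{\mathrm F}_j=\sqrt{P_f}\sum_{s\in\tilde{\mathcal S}_j}\sqrt{\tilde\eta_{sj}}\tilde{\mathbf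 g}_{sk}^H\tilde{\mathbf w}_{sj}$, $\widetilde{\mathrm{UI}}^{\mathrm N}_i=\sqrt{P_n}\sum_{s\in\bar{\mathcal S}_i}\sqrt{\bar\eta_{si}}\tilde{\mathbf g}_{sk}^H\bar{\mathbf w}_{si}$. Expectations are over $\tilde{\mathbf H}_2$; $\delta_{ss'}$ is the Kronecker delta. *)

(* Defs.v *)
From HB Require Import structures.
From mathcomp Require Import all_boot all_order all_algebra.
From mathcomp Require Import all_classical all_reals all_analysis.
From mathcomp Require Import complex.
From mathcomp Require mxtens.

Set Implicit Arguments.
Unset Strict Implicit.
Unset Printing Implicit Defensive.

Import Order.TTheory GRing.Theory Num.Theory.
Import numFieldNormedType.Exports.

Local Open Scope classical_set_scope.
Local Open Scope ring_scope.
Local Open Scope complex_scope.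
Local Open Scope sesquilinear_scope.

Definition log2 {R : realType} (x : R) : R := ln x / ln 2.

Definition expi {R : realType} (t : R) : R[i] := cos t +i* sin t.

(* The norm of R[i] takes its values in R[i]. *)
Definition modulus {R : realType} (z : R[i]) : R := complex.Re `|z|.

Section Probability.
Context {d : measure_display} {T : measurableType d} {R : realType}.
Variable P : probability T R.

Definition mutually_independent {I : finType} {d' : measure_display}
    {U : measurableType d'} (X : I -> T -> U) : Prop :=
  forall (J : {set I}) (A : I -> set U), (forall i, measurable (A i)) ->
    P (\bigcap_(i in [set` J]) (X i @^-1` A i)) =
    (\prod_(i in J) P (X i @^-1` A i))%E.

Definition re_im (Z : T -> R[i])
    (w : T) : measurableTypeR R * measurableTypeR R :=
  (complex.Re (Z w), complex.Im (Z w)).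

(* The second parameter of [normal_prob] is the standard deviation; the unit
   variance of a CN(0,1) variable is shared equally by its real and imaginary
   parts, which are independent. *)
Definition std_complex_gaussian (Z : T -> R[i]) : Prop :=
  measurable_fun setT (re_im Z) /\
  forall A : set (measurableTypeR R * measurableTypeR R), measurable A ->
    P (re_im Z @^-1` A) =
    (normal_prob 0 (Num.sqrt (2^-1 : R)) \x
     normal_prob 0 (Num.sqrt (2^-1 : R)))%E A.

Definition iid_CN01 {m n : nat} (Z : T -> 'M[R[i]]_(m, n)) : Prop :=
  mutually_independent
    (fun ij : 'I_m * 'I_n => re_im (fun w => Z w ij.1 ij.2)) /\
  forall i j, std_complex_gaussian (fun w => Z w i j).

Definition mean (X : T -> R) : R := fine 'E_P[X].

Definition cmean (Z : T -> R[i]) : R[i] :=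
  mean (fun w => complex.Re (Z w)) +i* mean (fun w => complex.Im (Z w)).

End Probability.

(* Indices start at 0: [ordinal n] plays the role of {1, ..., n}.
   [near] and [far] refer to the two populations of users; the [aod_*] angles
   are those of a_M, the [aoa_*] angles those of b_N in the array-to-RIS
   channel, and the [user_*] angles those of the RIS-to-user channels.
   [rice] is the Rician factor iota, [pathloss] is zeta, and [noise k] is the
   power sigma_k^2. *)
Class system (R : realType) := System {
  Mx : nat; My : nat;
  nsub : nat;
  N1 : nat; N2 : nat;
  Kn : nat; Kf : nat;
  wavelength : R;
  ux : 'I_Kn -> R; uy : 'I_Kn -> R; uz : 'I_Kn -> R;
  theta : 'I_(N1 * N2) -> R;
  rice : R;
  pathloss : R;
  aod_az : R; aod_el : R;
  aoa_az : R; aoa_el : R;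
  user_az : 'I_Kf -> R; user_el : 'I_Kf -> R;
  varsigma : 'I_Kf -> R;
  vr_near : 'I_Kn -> {set 'I_nsub};
  vr_far : 'I_Kf -> {set 'I_nsub};
  Pn : R; Pf : R;
  eta_near : 'I_nsub -> 'I_Kn -> R;
  eta_far : 'I_nsub -> 'I_Kf -> R;
  noise : 'I_Kf -> R;
  odd_Mx : odd Mx;
  odd_My : odd My;
  dvd_nsub : (nsub %| Mx * My)%N;
  wavelength_gt0 : 0 < wavelength;
  uz_gt0 : forall i, 0 < uz i;
  theta_bound : forall n, 0 <= theta n < 2 * pi;
  rice_ge0 : 0 <= rice;
  pathloss_gt0 : 0 < pathloss;
  varsigma_gt0 : forall k, 0 < varsigma k;
  Pn_gt0 : 0 < Pn;
  Pf_gt0 : 0 < Pf;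
  eta_near_ge0 : forall s i, 0 <= eta_near s i;
  eta_far_ge0 : forall s k, 0 <= eta_far s k;
  noise_gt0 : forall k, 0 < noise k
}.

Section Model.
Context {R : realType} {sys : system R}.

Local Notation C := R[i].

Definition nant : nat := Mx * My.
Definition nris : nat := N1 * N2.
Definition Mstar : nat := nant %/ nsub.

Lemma nsub_Mstar : (nsub * Mstar)%N = nant.
Proof. by rewrite mulnC divnK // dvd_nsub. Qed.

(* [mxtens_index (s, t)] is the index s * Mstar + t. *)
Definition antenna (s : 'I_nsub) (t : 'I_Mstar) : 'I_nant :=
  cast_ord nsub_Mstar (mxtens.mxtens_index (s, t)).

Definition spacing : R := wavelength / 2.
Definition ris_spacing : R := wavelength / 2.

Definition ant_x (m : 'I_nant) : R := - ((Mx%:R - 1) / 2) + (m %% Mx)%N%:R.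
Definition ant_y (m : 'I_nant) : R := (My%:R - 1) / 2 - (m %/ Mx)%N%:R.

Definition dist (m : 'I_nant) (i : 'I_Kn) : R :=
  Num.sqrt ((ux i - ant_x m * spacing) ^+ 2
            + (uy i - ant_y m * spacing) ^+ 2 + uz i ^+ 2).

Definition aperture : R := wavelength ^+ 2 / (4 * pi).

Definition gbar_entry (m : 'I_nant) (i : 'I_Kn) : C :=
  (Num.sqrt (aperture / (4 * pi)
             * (uz i * ((ux i - ant_x m * spacing) ^+ 2 + uz i ^+ 2)
                / dist m i ^+ 5)))%:C
  * expi (- (2 * pi * dist m i / wavelength)).

Definition gbar (s : 'I_nsub) (i : 'I_Kn) : 'cV[C]_Mstar :=
  \col_t gbar_entry (antenna s t) i.

(* [mxtens.tensmx] is the Kronecker product; its width 1 * 1 is 1. *)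
Definition steering (n1 n2 : nat) (delta az el : R) : 'cV[C]_(n1 * n2) :=
  mxtens.tensmx
    (\col_(m < n1) expi (2 * pi * m%:R * delta * cos el * sin az / wavelength))
    (\col_(m < n2) expi (2 * pi * m%:R * delta * sin el / wavelength)).

Definition a_M : 'cV[C]_nant := steering Mx My spacing aod_az aod_el.

Definition b_N (az el : R) : 'cV[C]_nris := steering N1 N2 ris_spacing az el.

Definition b_ris : 'cV[C]_nris := b_N aoa_az aoa_el.

Definition Theta : 'M[C]_nris := diag_mx (\row_n expi (theta n)).

Definition alpha2 : C := (Num.sqrt (rice * pathloss / (rice + 1)))%:C.
Definition beta2 : C := (Num.sqrt (pathloss / (rice + 1)))%:C.

Definition columns (s : 'I_nsub) (H : 'M[C]_(nris, nant)) :
  'M[C]_(nris, Mstar) := colsub (antenna s) H.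

Definition H2bar : 'M[C]_(nris, nant) := b_ris *m a_M ^t*.
Definition H2bar_ (s : 'I_nsub) : 'M[C]_(nris, Mstar) := columns s H2bar.

Definition h_ris (k : 'I_Kf) : 'cV[C]_nris :=
  (Num.sqrt (varsigma k))%:C *: b_N (user_az k) (user_el k).

Section Random.
Context {d : measure_display} {T : measurableType d}.
Variables (P : probability T R) (H2tilde : T -> 'M[C]_(nris, nant)).

Definition H2 (w : T) : 'M[C]_(nris, nant) :=
  alpha2 *: H2bar + beta2 *: H2tilde w.

Definition gtildeH (s : 'I_nsub) (k : 'I_Kf) (w : T) : 'rV[C]_Mstar :=
  (h_ris k) ^t* *m Theta *m columns s (H2 w).

Definition gtilde (s : 'I_nsub) (k : 'I_Kf) (w : T) : 'cV[C]_Mstar :=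
  (gtildeH s k w) ^t*.

Definition mrt_near (s : 'I_nsub) (i : 'I_Kn) (w : T) : 'cV[C]_Mstar :=
  gbar s i.
Definition mrt_far (s : 'I_nsub) (j : 'I_Kf) (w : T) : 'cV[C]_Mstar :=
  gtilde s j w.

Section SpectralEfficiency.
Variables (wbar : 'I_nsub -> 'I_Kn -> T -> 'cV[C]_Mstar)
          (wtilde : 'I_nsub -> 'I_Kf -> T -> 'cV[C]_Mstar).
Variable k : 'I_Kf.

Definition gain (w : T) : C :=
  \sum_(s in vr_far k)
    (Num.sqrt (eta_far s k))%:C * (gtildeH s k w *m wtilde s k w) 0 0.

Definition DS : C := (Num.sqrt Pf)%:C * cmean P gain.

Definition BU (w : T) : C := (Num.sqrt Pf)%:C * (gain w - cmean P gain).

Definition UIF (j : 'I_Kf) (w : T) : C :=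
  (Num.sqrt Pf)%:C * \sum_(s in vr_far j)
    (Num.sqrt (eta_far s j))%:C * (gtildeH s k w *m wtilde s j w) 0 0.

Definition UIN (i : 'I_Kn) (w : T) : C :=
  (Num.sqrt Pn)%:C * \sum_(s in vr_near i)
    (Num.sqrt (eta_near s i))%:C * (gtildeH s k w *m wbar s i w) 0 0.

Definition SINR : R :=
  modulus DS ^+ 2 /
  (mean P (fun w => modulus (BU w) ^+ 2)
   + \sum_(j | j != k) mean P (fun w => modulus (UIF j w) ^+ 2)
   + \sum_i mean P (fun w => modulus (UIN i w) ^+ 2)
   + noise k).

Definition SE : R := log2 (1 + SINR).

End SpectralEfficiency.
End Random.

Definition HHbar (s : 'I_nsub) : 'M[C]_nris := H2bar_ s *m (H2bar_ s) ^t*.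

Definition Mmat (j : 'I_Kf) : 'M[C]_nris :=
  Theta ^t* *m h_ris j *m (h_ris j) ^t* *m Theta.

(* h_k^H Theta A Theta^H h_k *)
Definition quad (k : 'I_Kf) (A : 'M[C]_nris) : C :=
  ((h_ris k) ^t* *m Theta *m A *m Theta ^t* *m h_ris k) 0 0.

Definition kron (s s' : 'I_nsub) : C := (s == s')%:R.

Definition meanHH (s : 'I_nsub) : 'M[C]_nris :=
  alpha2 ^+ 2 *: HHbar s + (beta2 ^+ 2 * Mstar%:R)%:M.

Definition Psi (k : 'I_Kf) (s : 'I_nsub) : C := quad k (meanHH s).

Definition Bmat (k : 'I_Kf) (s s' : 'I_nsub) : 'M[C]_Mstar :=
  alpha2 ^+ 2 *: ((H2bar_ s') ^t* *m Mmat k *m H2bar_ s)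
  + (kron s s' * (varsigma k)%:C * beta2 ^+ 2 * nris%:R)%:M.

Definition Xi (k : 'I_Kf) (i : 'I_Kn) (s s' : 'I_nsub) : R :=
  complex.Re (((gbar s' i) ^t* *m Bmat k s s' *m gbar s i) 0 0).

Definition a_coef (k : 'I_Kf) (s : 'I_nsub) : R :=
  complex.Re (quad k
    (((varsigma k)%:C * alpha2 ^+ 2 * beta2 ^+ 2 * nris%:R) *: HHbar s
     + (alpha2 ^+ 2 * beta2 ^+ 2 * Mstar%:R * (b_ris ^t* *m Mmat k *m b_ris) 0 0
        + (varsigma k)%:C * beta2 ^+ 4 * nris%:R * Mstar%:R)%:M)).

Definition Dmat (j : 'I_Kf) (s s' : 'I_nsub) : 'M[C]_nris :=
  meanHH s *m Mmat j *m meanHH s'.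

Definition Cmat (s : 'I_nsub) (j : 'I_Kf) : 'M[C]_nris :=
  alpha2 ^+ 4 *: (HHbar s *m Mmat j *m HHbar s)
  + beta2 ^+ 2 *:
    ((alpha2 ^+ 2 * Mstar%:R) *: (HHbar s *m Mmat j)
     + (alpha2 ^+ 2 * \tr (Mmat j)) *: HHbar s
     + (alpha2 ^+ 2 * \tr ((H2bar_ s) ^t* *m Mmat j *m H2bar_ s))%:M
     + (alpha2 ^+ 2 * Mstar%:R) *: (Mmat j *m HHbar s)
     + (beta2 ^+ 2 * Mstar%:R ^+ 2) *: Mmat j
     + (beta2 ^+ 2 * Mstar%:R * \tr (Mmat j))%:M).

Definition b_coef (k j : 'I_Kf) (s s' : 'I_nsub) : R :=
  complex.Re (quad k
    (kron s s' *: Cmat s j + (1 - kron s s') *: Dmat j s s')).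

Definition Delta (k : 'I_Kf) : R :=
  Pf * (\sum_(s in vr_far k) eta_far s k * a_coef k s)
  + Pf * (\sum_(j | j != k) \sum_(s in vr_far j) \sum_(s' in vr_far j)
            Num.sqrt (eta_far s j * eta_far s' j) * b_coef k j s s')
  + Pn * (\sum_i \sum_(s in vr_near i) \sum_(s' in vr_near i)
            Num.sqrt (eta_near s i * eta_near s' i) * Xi k i s s').

End Model.

(* Main.v *)
Require Import Defs.
From HB Require Import structures.
From mathcomp Require Import all_boot all_order all_algebra.
From mathcomp Require Import all_classical all_reals all_analysis.
From mathcomp Require Import measurable_realfun.
From mathcomp Require Import complex.
From mathcomp Require mxtens.
From mathcomp Require Import ring lra.

(* Write x = h_k^H Theta H_2 and y = h_j^H Theta H_2 for the rows seen by users
   k and j. Column by column they are affine in the Gaussian entries of the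
   scattered part: x_m = p_m + z_m and y_m = q_m + z'_m, where the pairs
   (z_m, z'_m) are centred circular Gaussian and independent for distinct
   columns. Every term of the SINR is the second moment of S = sum_m c_m x_m
   conj(y_m) or of S = sum_m c_m x_m. Wick's formula E[z1 conj(z2) z3 conj(z4)] =
   E[z1 conj(z2)] E[z3 conj(z4)] + E[z1 conj(z4)] E[z3 conj(z2)], together with
   the vanishing of all moments having unequally many conjugated and
   unconjugated factors, gives
     E|S|^2 = |E S|^2 + sum_m |c_m|^2 (E|z_m|^2 (|q_m|^2 + E|z'_m|^2)
                                       + E|z'_m|^2 |p_m|^2),
   and what remains is matrix algebra. Wick's formula itself follows from
   E[Z^a conj(Z)^b] = [a = b] a! for a single CN(0,1) variable and from the
   multiplicativity of expectation over independent variables. *)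

Set Implicit Arguments.
Unset Strict Implicit.
Unset Printing Implicit Defensive.

Import Order.TTheory GRing.Theory Num.Theory.
Import numFieldNormedType.Exports.
Local Open Scope classical_set_scope.
Local Open Scope ring_scope.

(** * Gaussian moments on the real line *)

(** The formula for E|S|^2 also holds when z' = z. So the case j = k needs no computation of its
    own: removing |E S|^2 leaves the beamforming uncertainty, and the same [gain_variance] sits on
    the diagonal s = s' of the interference coefficients. The covariance of z_m with z'_m enters
    only through the mean of S: one of the two Wick pairings rebuilds |E S|^2 and absorbs it, the
    other couples only forms of the same user. Distinct subarrays own disjoint columns, hence
    interact only through the product of their means; this is the origin of the Kronecker symbols
    and of the split between C and D. Sums over subarrays and antennas are therefore handled as one
    sum over columns, with weights that vanish outside the visibility region. On the
    measure-theoretic side a single change-of-measure statement is used three times: for the normal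
    density against Lebesgue measure, for the law of a real or imaginary part (weight 1), and for a
    product of independent factors, where all factors but one act as a density. *)

Section Density.
Context {d d' : measure_display} {T : measurableType d} {U : measurableType d'}
  {R : realType}.
Variables (mu : {measure set T -> \bar R}) (nu : {measure set U -> \bar R}).
Variables (X : T -> U) (W : T -> R).
Hypotheses (mX : measurable_fun setT X) (mW : measurable_fun setT W).
Hypothesis W0 : forall t, 0 <= W t.
(** This makes [nu] the image under [X] of the measure with density [W] with respect to [mu]. It is
    tested on indicators only, which is what each application can verify directly. *)
Hypothesis XW : forall A, measurable A ->
  (\int[mu]_t ((\1_A (X t))%:E * (W t)%:E) = nu A)%E.

Local Open Scope ereal_scope.
Import HBNNSimple.

Lemma integral_density_nnsfun (h : {nnsfun U >-> R}) :
  \int[mu]_t ((h (X t))%:E * (W t)%:E) = \int[nu]_u (h u)%:E.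
Proof.
have mh r : measurable_fun setT
    (fun t => (r * \1_(h @^-1` [set r]) (X t))%:E * (W t)%:E).
  apply: emeasurable_funM; apply/measurable_EFinP => //.
  by apply: measurable_funM => //; apply: measurableT_comp.
have h0 r u : 0 <= (r * \1_(h @^-1` [set r]) u)%:E.
  by rewrite EFinM nnfun_muleindic_ge0.
transitivity (\int[mu]_t (\sum_(r \in range h)
    ((r * \1_(h @^-1` [set r]) (X t))%:E * (W t)%:E))).
  apply: eq_integral => t _; rewrite fimfunE -fsumEFin// ge0_mule_fsuml//.
rewrite ge0_integral_fsum//; last first.
  by move=> r t _; apply: mule_ge0; [exact: h0|rewrite lee_fin].
under [RHS]eq_integral do rewrite fimfunE -fsumEFin//.
rewrite [RHS]ge0_integral_fsum//; last first.
  by move=> r; apply/measurable_EFinP/measurableT_comp.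
apply: eq_fsbigr => r; rewrite inE => -[u _ hur].
rewrite integralZl_indic_nnsfun// integral_indic// setIT.
under eq_integral do rewrite EFinM -muleA.
rewrite ge0_integralZl ?XW//.
- apply: emeasurable_funM; apply/measurable_EFinP => //.
  exact: measurableT_comp.
- by move=> t _; rewrite mule_ge0// lee_fin.
- by rewrite lee_fin -hur.
Qed.

Lemma ge0_integral_density (f : U -> \bar R) : measurable_fun setT f ->
  (forall u, 0 <= f u) -> \int[mu]_t (f (X t) * (W t)%:E) = \int[nu]_u f u.
Proof.
move=> mf f0; pose f_ := nnsfun_approx measurableT mf.
have cf u : (EFin \o f_^~ u) @ \oo --> f u.
  by apply: cvg_nnsfun_approx => // ? _; exact: f0.
have ndf u a b : (a <= b)%N -> (f_ a u <= f_ b u)%R.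
  by move=> ab; exact/lefP/nd_nnsfun_approx.
transitivity (limn (fun n => \int[mu]_t ((f_ n (X t))%:E * (W t)%:E))).
  rewrite -monotone_convergence//.
  - apply: eq_integral => t _; apply/esym/cvg_lim => //.
    by apply: cvgeZr => //; exact: cf.
  - move=> n; apply: emeasurable_funM; apply/measurable_EFinP => //.
    exact: measurableT_comp.
  - by move=> n t _; rewrite mule_ge0// lee_fin.
  - by move=> t _ a b ab; apply: lee_wpmul2r; rewrite lee_fin ?W0 ?ndf.
rewrite -(_ : limn (fun n => \int[nu]_u (f_ n u)%:E) = \int[nu]_u f u); last first.
  rewrite -monotone_convergence//.
  - by apply: eq_integral => t _; apply/cvg_lim => //; exact: cf.
  - by move=> n; exact/measurable_EFinP.
  - by move=> n t _; rewrite lee_fin.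
  - by move=> t _ a b ab; rewrite lee_fin ndf.
by congr (limn _); apply/funext => n; rewrite integral_density_nnsfun.
Qed.

Lemma integrable_density (f : U -> R) : measurable_fun setT f ->
  mu.-integrable setT (EFin \o (fun t => f (X t) * W t)%R) ->
  nu.-integrable setT (EFin \o f).
Proof.
move=> mf /integrableP[_ fi]; apply/integrableP; split.
  exact/measurable_EFinP.
rewrite -(ge0_integral_density (f := fun u => `|(f u)%:E|))//; last first.
  by apply: measurableT_comp => //; exact/measurable_EFinP.
apply: le_lt_trans fi; rewrite le_eqVlt; apply/orP; left; apply/eqP.
by apply: eq_integral => t _ /=; rewrite normrM (ger0_norm (W0 t)) EFinM.
Qed.

(** Since [W] is nonnegative, multiplication by it commutes with positive and negative parts, and
    the nonnegative case applies to each part. *)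
Lemma integral_density (f : U -> R) : measurable_fun setT f ->
  \int[mu]_t (f (X t) * W t)%:E = \int[nu]_u (f u)%:E.
Proof.
move=> mf; rewrite integralE [RHS]integralE.
have mfE : measurable_fun setT (EFin \o f) by exact/measurable_EFinP.
congr (_ - _).
- rewrite -(ge0_integral_density (f := (EFin \o f)^\+))//; last first.
    exact: measurable_funepos.
  apply: eq_integral => t _; rewrite !funeposE /=.
  by rewrite -!EFin_max -EFinM maxr_pMl// mul0r.
- rewrite -(ge0_integral_density (f := (EFin \o f)^\-))//; last first.
    exact: measurable_funeneg.
  apply: eq_integral => t _; rewrite !funenegE /=.
  by rewrite -!EFin_max -EFinM maxr_pMl// mul0r mulNr.
Qed.

End Density.

(** * Moments of exp(-x^2) and of the normal law of variance 1/2 *)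

Section GaussianMoments.
Context {R : realType}.
Local Notation mu := (@lebesgue_measure R).

Lemma exprn_le_expR (y : R) (k : nat) : 0 <= y -> y ^+ k <= k`!%:R * expR y.
Proof.
move=> y0; case: k => [|k].
  by rewrite expr0 fact0 mul1r -[leLHS]expR0 ler_expR.
rewrite mulrC -ler_pdivrMr ?ltr0n ?fact_gt0//.
by apply: le_trans (expR_ge1Dxn k y0); rewrite lerDr.
Qed.

(** The exponent has no factor 1/2 because variance 1/2 gives the density exp(-x^2) / sqrt(pi). *)
Definition gaussM (k : nat) (x : R) : R := x ^+ k * expR (- x ^+ 2).

(** Half of the exponent is spent on the monomial, through |x|^k <= 1 + x^(2k) and y^k <= k! exp(y)
    at y = x^2 / 2; the other half remains as a standard Gaussian. *)
Lemma gaussM_bound (k : nat) (x : R) :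
  `|gaussM k x| <= (1 + 2 ^+ k * k`!%:R) * expR (- (x ^+ 2 / 2)).
Proof.
rewrite /gaussM normrM normrX (ger0_norm (expR_ge0 _)).
have -> : - x ^+ 2 = - (x ^+ 2 / 2) + - (x ^+ 2 / 2) by field.
rewrite expRD mulrA ler_pM2r ?expR_gt0// expRN ler_pdivrMr ?expR_gt0//.
have y0 : 0 <= x ^+ 2 / 2 by rewrite divr_ge0 ?sqr_ge0.
have e1 : 1 <= expR (x ^+ 2 / 2) by rewrite -[leLHS]expR0 ler_expR.
have h : `|x| ^+ k <= 1 + (x ^+ 2) ^+ k.
  rewrite -real_normK ?num_real// exprAC.
  by have := sqr_ge0 (`|x| ^+ k - 1); have := sqr_ge0 (`|x| ^+ k); nra.
apply: (le_trans h); rewrite mulrDl mul1r lerD//.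
have -> : (x ^+ 2) ^+ k = 2 ^+ k * (x ^+ 2 / 2) ^+ k.
  by rewrite -exprMn mulrC divfK.
rewrite -[leRHS]mulrA; apply: ler_wpM2l; first by rewrite exprn_ge0.
exact: exprn_le_expR.
Qed.

Lemma continuous_gaussM k : continuous (gaussM k).
Proof.
move=> x; apply: cvgM; first exact: exprn_continuous.
apply: (cvg_comp _ expR); last exact: continuous_expR.
by apply: (@cvgN _ R^o); exact: exprn_continuous.
Qed.

Lemma measurable_gaussM k : measurable_fun setT (gaussM k).
Proof. by apply: continuous_measurable_fun; exact: continuous_gaussM. Qed.

Lemma integrable_gaussM k : mu.-integrable setT (EFin \o gaussM k).
Proof.
have i1 := @integrable_normal_pdf R 0 1.
(* Dividing by [normal_peak] turns the bound into a multiple of the standard normal density. *)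
pose c := (1 + 2 ^+ k * k`!%:R) / normal_peak (1 : R).
apply: (le_integrable measurableT _ _ (integrableZl measurableT c i1)).
  by apply/measurable_EFinP; exact: measurable_gaussM.
move=> x _ /=; rewrite lee_fin (le_trans (gaussM_bound k x))//.
rewrite (le_trans _ (ler_norm _))// normal_pdfE ?oner_neq0//.
rewrite /c mulrA divfK; last by rewrite gt_eqF// normal_peak_gt0 ?oner_neq0.
by rewrite /normal_fun subr0 expr1n mulNr.
Qed.

(** The sign [s] covers both ends of the line. The crude estimate exp(- n^2 / 2) <= 2 / n, a
    consequence of 1 + y <= exp(y), is enough. *)
Lemma cvg_gaussM (k : nat) (s : R) : `|s| = 1 ->
  (fun n : nat => gaussM k (s * n%:R)) @ \oo --> (0 : R).
Proof.
move=> s1.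
have h (n : nat) : (0 < n)%N ->
    `|gaussM k (s * n%:R)| <= (1 + 2 ^+ k * k`!%:R) * (2 * n%:R^-1).
  move=> n0; apply: (le_trans (gaussM_bound _ _)); rewrite ler_pM2l; last first.
    by rewrite ltr_pwDl// mulr_ge0.
  rewrite -real_normK ?num_real// normrM s1 mul1r normr_nat.
  rewrite expRN -[leRHS]invrK.
  rewrite lef_pV2 ?posrE ?expR_gt0 ?invr_gt0 ?mulr_gt0 ?invr_gt0 ?ltr0n//.
  rewrite invfM invrK (le_trans _ (expR_ge1Dx _))//.
  have : (1 : R) <= n%:R by rewrite ler1n.
  nra.
apply/norm_cvg0P.
apply: (@squeeze_cvgr _ _ _ _ (fun=> 0)
  (fun n : nat => (1 + 2 ^+ k * k`!%:R) * (2 * n%:R^-1))).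
- near=> n; rewrite normr_ge0/= h//.
  by near: n; exists 1%N.
- exact: cvg_cst.
- rewrite -[X in _ --> X](mulr0 (1 + 2 ^+ k * k`!%:R)); apply: cvgMr.
  rewrite -[X in _ --> X](mulr0 2); apply: cvgMr.
  apply/gtr0_cvgV0; first by exists 1%N => // n /=; rewrite ltr0n.
  exact: cvgr_idn.
Unshelve. all: end_near. Qed.

(** The integrals of [f] over [-n, n] tend to the full integral by dominated convergence, and equal
    F(n) - F(-n) by the fundamental theorem of calculus; limits are unique. *)
Lemma integral_derive_vanishing (f F : R -> R) : continuous f ->
  (forall x : R, is_derive x (1 : R) F (f x)) ->
  mu.-integrable setT (EFin \o f) ->
  (fun n : nat => F n%:R) @ \oo --> (0 : R) ->
  (fun n : nat => F (- n%:R)) @ \oo --> (0 : R) ->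
  (\int[mu]_x (f x)%:E = 0)%E.
Proof.
move=> cf dF fi F1 F2.
have mf : measurable_fun setT f by exact: continuous_measurable_fun.
pose f_ (n : nat) : R -> \bar R := (EFin \o f) \_ `[- n%:R, n%:R].
have h1 : (\int[mu]_x f_ n x @[n --> \oo] --> \int[mu]_x (f x)%:E)%E.
  apply: (@dominated_cvg _ _ R mu setT measurableT f_ (EFin \o f)
    (abse \o EFin \o f)).
  - move=> n; apply/measurable_restrict => //.
    exact/measurable_funTS/measurable_EFinP.
  - move=> x _; apply: cvg_near_cst.
    near=> n; rewrite /f_ patchE ifT// inE/= in_itv/= -ler_norml.
    by near: n; exact: nbhs_infty_ger.
  - by move=> x _.
  - exact: integrable_abse.
  - move=> n x _; rewrite /f_ patchE; case: ifP => //= _.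
    by rewrite normr0 lee_fin.
have h2 : ((F n%:R - F (- n%:R))%:E @[n --> \oo] --> (0 : R)%:E)%E.
  apply: cvg_EFin; first by near=> n.
  rewrite -[X in _ --> X](subr0 0).
  exact: (cvgB F1 F2).
apply: (cvg_unique _ h1); first exact: ereal_hausdorff.
apply: cvg_trans h2; apply: near_eq_cvg; near=> n.
rewrite /f_ -integral_mkcond (@continuous_FTC2 _ f F)//.
- rewrite gtrN// ltr0n; near: n; exact: nbhs_infty_gt.
- exact: continuous_subspaceT.
- split.
  + by move=> x _; have := dF x; case.
  + apply: cvg_at_right_filter.
    apply: differentiable_continuous; apply/derivable1_diffP.
    by have := dF (- n%:R); case.
  + apply: cvg_at_left_filter.
    apply: differentiable_continuous; apply/derivable1_diffP.
    by have := dF (n%:R); case.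
- by move=> x _; rewrite derive1E; apply: derive_val.
Unshelve. all: end_near. Qed.

Lemma is_derive_gaussM0 (x : R) :
  is_derive x (1 : R) (gaussM 0) (- 2 * gaussM 1 x).
Proof.
have -> : gaussM 0 = fun x => expR (- x ^+ 2).
  by apply/funext => y; rewrite /gaussM expr0 mul1r.
apply: is_derive_eq.
rewrite /gaussM /GRing.scale/=; ring.
Qed.

Lemma is_derive_gaussMS (k : nat) (x : R) :
  is_derive x (1 : R) (gaussM k.+1) (k.+1%:R * gaussM k x - 2 * gaussM k.+2 x).
Proof.
have -> : gaussM k.+1 = (fun x => x ^+ k.+1) * (fun x => expR (- x ^+ 2)).
  by apply/funext => y; rewrite /gaussM.
have d1 : is_derive x (1 : R) (fun x : R => x ^+ k.+1) (k.+1%:R * x ^+ k).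
  apply: DeriveDef; first exact: exprn_derivable.
  by rewrite exp_derive /GRing.scale/= mulr1.
have d2 : is_derive x (1 : R) (fun x : R => expR (- x ^+ 2))
    (- (2 * x * expR (- x ^+ 2))).
  by apply: is_derive_eq; rewrite /GRing.scale/=; ring.
apply: is_derive_eq.
rewrite /gaussM /GRing.scale/= !exprS; ring.
Qed.

(* gaussM k.+1 vanishes at infinity, so that its derivative integrates to 0. *)
Lemma Rintegral_gaussMSS (k : nat) : (\int[mu]_x gaussM k.+2 x)%R =
  k.+1%:R / 2 * (\int[mu]_x gaussM k x)%R.
Proof.
have ik n := integrable_gaussM n.
pose f x := k.+1%:R * gaussM k x - 2 * gaussM k.+2 x.
have i1 : mu.-integrable setT (EFin \o (fun x => k.+1%:R * gaussM k x)).
  exact: (@integrableZl _ _ _ mu _ measurableT k.+1%:R _ (ik k)).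
have i2 : mu.-integrable setT (EFin \o (fun x => 2 * gaussM k.+2 x)).
  exact: (@integrableZl _ _ _ mu _ measurableT 2 _ (ik k.+2)).
have : (\int[mu]_x (f x)%:E = 0)%E.
  apply: (@integral_derive_vanishing _ (gaussM k.+1)).
  - move=> x; apply: cvgB; apply: cvgMr; exact: continuous_gaussM.
  - by move=> x; exact: is_derive_gaussMS.
  - exact: (@integrableB _ _ _ mu _ measurableT _ _ i1 i2).
  - under eq_fun do rewrite -[_%:R]mul1r.
    by apply: cvg_gaussM; rewrite normr1.
  - under eq_fun do rewrite -mulN1r.
    by apply: cvg_gaussM; rewrite normrN1.
move=> /(congr1 fine) h; have {h} : (\int[mu]_x f x)%R = 0 by [].
rewrite /f RintegralB// !RintegralZl// => /eqP.
rewrite subr_eq0 => /eqP h; apply: (@mulfI _ 2) => //.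
by rewrite -h; field.
Qed.

(** [gaussM 1] is a multiple of the derivative of [gaussM 0], so the vanishing argument takes the
    place of the symmetry x -> -x. *)
Lemma Rintegral_gaussM1 : (\int[mu]_x gaussM 1 x)%R = 0.
Proof.
have ik n := integrable_gaussM n.
have : (\int[mu]_x (- 2 * gaussM 1 x)%:E = 0)%E.
  apply: (@integral_derive_vanishing _ (gaussM 0)).
  - move=> x; apply: cvgMr; exact: continuous_gaussM.
  - by move=> x; exact: is_derive_gaussM0.
  - exact: (@integrableZl _ _ _ mu _ measurableT (- 2) _ (ik 1)).
  - under eq_fun do rewrite -[_%:R]mul1r.
    by apply: cvg_gaussM; rewrite normr1.
  - under eq_fun do rewrite -mulN1r.
    by apply: cvg_gaussM; rewrite normrN1.
move=> /(congr1 fine) h; have {h} : (\int[mu]_x (- 2 * gaussM 1 x))%R = 0 by [].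
by rewrite RintegralZl// => /eqP; rewrite mulf_eq0 oppr_eq0 pnatr_eq0/= => /eqP.
Qed.

(* The law of the real and imaginary parts of a CN(0,1) variable. *)
Local Notation halfN := (normal_prob (0 : R) (Num.sqrt 2^-1)).

Definition halfN_mom (k : nat) : R := (\int[halfN]_x (x ^+ k))%R.

Lemma normal_pdf_half (x : R) :
  normal_pdf 0 (Num.sqrt 2^-1) x = (Num.sqrt pi)^-1 * expR (- x ^+ 2).
Proof.
have s0 : Num.sqrt 2^-1 != 0 :> R by rewrite gt_eqF// sqrtr_gt0 invr_gt0.
rewrite normal_pdfE// /normal_peak /normal_fun sqr_sqrtr ?invr_ge0//.
congr ((Num.sqrt _)^-1 * expR _); first by rewrite -mulr_natr; field.
by rewrite subr0 -mulr_natr; field.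
Qed.

Lemma halfN_density (A : set (measurableTypeR R)) : measurable A ->
  (\int[mu]_t ((\1_A t)%:E * (normal_pdf 0 (Num.sqrt 2^-1) t)%:E) = halfN A)%E.
Proof.
move=> mA; rewrite /normal_prob [RHS]integral_mkcond.
apply: eq_integral => x _; rewrite patchE indicE.
by case: ifP => xA; rewrite ?mul1e ?mul0e.
Qed.

Lemma halfN_moment (k : nat) :
  halfN.-integrable setT (EFin \o (fun x => x ^+ k)) /\
  halfN_mom k = (Num.sqrt pi)^-1 * (\int[mu]_x gaussM k x)%R.
Proof.
have mpdf := @measurable_normal_pdf R 0 (Num.sqrt 2^-1).
have pdf0 := @normal_pdf_ge0 R 0 (Num.sqrt 2^-1).
have mX : measurable_fun setT (fun x : R => x ^+ k) by exact: exprn_measurable.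
have E : (fun t : R => t ^+ k * normal_pdf 0 (Num.sqrt 2^-1) t) =
    (fun t => (Num.sqrt pi)^-1 * gaussM k t).
  by apply/funext => t; rewrite normal_pdf_half mulrCA.
split.
- apply: (@integrable_density _ _ _ _ R mu halfN id _ _ mpdf pdf0
    halfN_density) => //.
  rewrite E.
  exact: (@integrableZl _ _ _ mu _ measurableT _ _ (integrable_gaussM k)).
- rewrite /halfN_mom /Rintegral.
  rewrite -(@integral_density _ _ _ _ R mu halfN id _ _ mpdf pdf0
    halfN_density) => //.
  rewrite -RintegralZl//; last exact: integrable_gaussM.
  by congr fine; apply: eq_integral => x _; rewrite normal_pdf_half mulrCA.
Qed.

Lemma halfN_mom0 : halfN_mom 0 = 1.
Proof.
rewrite /halfN_mom /Rintegral; under eq_integral do rewrite expr0.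
by rewrite integral_cst// mul1e [X in fine X]probability_setT.
Qed.

Lemma halfN_mom1 : halfN_mom 1 = 0.
Proof. by rewrite (halfN_moment 1).2 Rintegral_gaussM1 mulr0. Qed.

Lemma halfN_momSS (k : nat) : halfN_mom k.+2 = k.+1%:R / 2 * halfN_mom k.
Proof. by rewrite !(halfN_moment _).2 Rintegral_gaussMSS mulrCA. Qed.

End GaussianMoments.

(** * Complex random variables with finite moments *)

Section Modulus.
Context {R : realType}.
Local Open Scope complex_scope.
Implicit Types z : R[i].

Lemma modulusE z :
  modulus z = Num.sqrt (complex.Re z ^+ 2 + complex.Im z ^+ 2).
Proof. by rewrite /modulus normc_def. Qed.

Lemma modulusC z : (modulus z)%:C = `|z|.
Proof. by rewrite modulusE normc_def. Qed.

Lemma modulus_ge0 z : 0 <= modulus z.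
Proof. by rewrite modulusE sqrtr_ge0. Qed.

Lemma modulusM z1 z2 : modulus (z1 * z2) = modulus z1 * modulus z2.
Proof. by apply: (@complexI R); rewrite rmorphM/= !modulusC normrM. Qed.

Lemma ler_modulusD z1 z2 : modulus (z1 + z2) <= modulus z1 + modulus z2.
Proof. by rewrite -lecR rmorphD/= !modulusC ler_normD. Qed.

Lemma modulusJ z : modulus z^*%C = modulus z.
Proof. by case: z => a b; rewrite !modulusE /= sqrrN. Qed.

Lemma modulus_real (x : R) : modulus x%:C = `|x|.
Proof. by rewrite modulusE /= expr0n addr0 sqrtr_sqr. Qed.

Lemma modulus_Re z : `|complex.Re z| <= modulus z.
Proof. by rewrite modulusE -sqrtr_sqr ler_wsqrtr// lerDl sqr_ge0. Qed.

Lemma modulus_Im z : `|complex.Im z| <= modulus z.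
Proof. by rewrite modulusE -sqrtr_sqr ler_wsqrtr// lerDr sqr_ge0. Qed.

Lemma sqr_modulus z : (modulus z ^+ 2)%:C = z * z^*%C.
Proof. by rewrite rmorphXn/= modulusC sqr_normc. Qed.

End Modulus.

Lemma exprD_le {R : realType} (n : nat) (a b : R) : 0 <= a -> 0 <= b ->
  (a + b) ^+ n <= 2 ^+ n * (a ^+ n + b ^+ n).
Proof.
move=> a0 b0; have [ab|/ltW ba] := leP a b.
- apply: (@le_trans _ _ ((2 * b) ^+ n)).
    by rewrite lerXn2r ?nnegrE ?addr_ge0 ?mulr_ge0//; lra.
  by rewrite exprMn ler_wpM2l ?exprn_ge0// lerDr exprn_ge0.
- apply: (@le_trans _ _ ((2 * a) ^+ n)).
    by rewrite lerXn2r ?nnegrE ?addr_ge0 ?mulr_ge0//; lra.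
  by rewrite exprMn ler_wpM2l ?exprn_ge0// lerDl exprn_ge0.
Qed.

Section MeasurableComplex.
Context {d : measure_display} {T : measurableType d} {R : realType}.
Implicit Types f g : T -> R[i].

Definition complex_measurable f : Prop :=
  measurable_fun setT (fun w => complex.Re (f w)) /\
  measurable_fun setT (fun w => complex.Im (f w)).

Lemma complex_measurableM f g : complex_measurable f -> complex_measurable g ->
  complex_measurable (fun w => f w * g w).
Proof.
move=> [mfr mfi] [mgr mgi]; split.
- have E w : complex.Re (f w * g w) =
    complex.Re (f w) * complex.Re (g w) - complex.Im (f w) * complex.Im (g w).
    by case: (f w) (g w) => ? ? [].
  by under eq_fun do rewrite E; apply: measurable_funB; apply: measurable_funM.
- have E w : complex.Im (f w * g w) =
    complex.Re (f w) * complex.Im (g w) + complex.Im (f w) * complex.Re (g w).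
    by case: (f w) (g w) => ? ? [].
  by under eq_fun do rewrite E; apply: measurable_funD; apply: measurable_funM.
Qed.

Lemma complex_measurableX f n : complex_measurable f ->
  complex_measurable (fun w => f w ^+ n).
Proof.
move=> mf; elim: n => [|n IH].
  by under eq_fun do rewrite expr0; split; exact: measurable_cst.
by under eq_fun do rewrite exprS; exact: complex_measurableM.
Qed.

End MeasurableComplex.

Section FiniteMoments.
Context {d : measure_display} {T : measurableType d} {R : realType}.
Variable P : probability T R.
Local Open Scope complex_scope.
Implicit Types f g : T -> R[i].

(* Unlike integrability, this is stable under products. *)
Definition finite_moments f : Prop :=
  [/\ measurable_fun setT (fun w => complex.Re (f w)),
      measurable_fun setT (fun w => complex.Im (f w)) &
      forall n, P.-integrable setT (EFin \o (fun w => modulus (f w) ^+ n))].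

Lemma measurable_modulus f :
  measurable_fun setT (fun w => complex.Re (f w)) ->
  measurable_fun setT (fun w => complex.Im (f w)) ->
  measurable_fun setT (fun w => modulus (f w)).
Proof.
move=> mr mi; under eq_fun do rewrite modulusE.
apply: measurableT_comp.
  by apply: continuous_measurable_fun; exact: sqrt_continuous.
by apply: measurable_funD; apply: measurable_funX.
Qed.

Lemma finite_moments_le f (g : nat -> T -> R) :
  measurable_fun setT (fun w => complex.Re (f w)) ->
  measurable_fun setT (fun w => complex.Im (f w)) ->
  (forall n w, modulus (f w) ^+ n <= g n w) ->
  (forall n, P.-integrable setT (EFin \o g n)) -> finite_moments f.
Proof.
move=> mr mi fg ig; split => // n.
apply: (le_integrable measurableT _ _ (ig n)).
  by apply/measurable_EFinP/measurable_funX; exact: measurable_modulus.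
move=> w _ /=; rewrite lee_fin.
rewrite ger0_norm ?exprn_ge0 ?modulus_ge0//.
exact: le_trans (fg n w) (ler_norm _).
Qed.

Lemma finite_moments_dom f g :
  measurable_fun setT (fun w => complex.Re (f w)) ->
  measurable_fun setT (fun w => complex.Im (f w)) ->
  (forall w, modulus (f w) <= modulus (g w)) ->
  finite_moments g -> finite_moments f.
Proof.
move=> mr mi fg [_ _ ig]; apply: (finite_moments_le mr mi _ ig) => n w.
by rewrite lerXn2r ?nnegrE ?modulus_ge0.
Qed.

(** From ab <= a^2 + b^2, the n-th moment of the product is controlled by the moments of order 2n of
    the factors. *)
Lemma finite_momentsM f g : finite_moments f -> finite_moments g ->
  finite_moments (fun w => f w * g w).
Proof.
move=> [mfr mfi fi] [mgr mgi gi].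
apply: (@finite_moments_le _
  (fun n w => modulus (f w) ^+ n.*2 + modulus (g w) ^+ n.*2)).
- by case: (@complex_measurableM _ _ _ f g).
- by case: (@complex_measurableM _ _ _ f g).
- move=> n w; rewrite modulusM exprMn -!muln2 !exprM.
  have := modulus_ge0 (f w); have := modulus_ge0 (g w).
  move=> /(exprn_ge0 n); set a := _ ^+ n => a0.
  move=> /(exprn_ge0 n); set b := _ ^+ n => b0.
  by have := sqr_ge0 (a - b); nra.
- by move=> n; exact: (integrableD measurableT (fi n.*2) (gi n.*2)).
Qed.

Lemma finite_momentsD f g : finite_moments f -> finite_moments g ->
  finite_moments (fun w => f w + g w).
Proof.
move=> [mfr mfi fi] [mgr mgi gi].
apply: (@finite_moments_le _
  (fun n w => 2 ^+ n * (modulus (f w) ^+ n + modulus (g w) ^+ n))).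
- have E w : complex.Re (f w + g w) = complex.Re (f w) + complex.Re (g w).
    by case: (f w) (g w) => ? ? [].
  by under eq_fun do rewrite E; apply: measurable_funD.
- have E w : complex.Im (f w + g w) = complex.Im (f w) + complex.Im (g w).
    by case: (f w) (g w) => ? ? [].
  by under eq_fun do rewrite E; apply: measurable_funD.
- move=> n w; have a0 := modulus_ge0 (f w); have b0 := modulus_ge0 (g w).
  apply: le_trans (exprD_le _ a0 b0).
  by rewrite lerXn2r ?nnegrE ?modulus_ge0 ?addr_ge0// ler_modulusD.
- move=> n; have fgi := integrableD measurableT (fi n) (gi n).
  exact: (@integrableZl _ _ _ P _ measurableT (2 ^+ n) _ fgi).
Qed.

Lemma finite_momentsJ f : finite_moments f ->
  finite_moments (fun w => (f w)^*%C).
Proof.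
move=> fmf; have [mfr mfi _] := fmf.
apply: finite_moments_dom fmf.
- have E w : complex.Re (f w)^*%C = complex.Re (f w) by case: (f w).
  by under eq_fun do rewrite E.
- have E w : complex.Im (f w)^*%C = - complex.Im (f w) by case: (f w).
  by under eq_fun do rewrite E; exact: measurableT_comp.
- by move=> w; rewrite modulusJ.
Qed.

Lemma finite_moments_cst (c : R[i]) : finite_moments (fun=> c).
Proof.
apply: (@finite_moments_le _ (fun n _ => modulus c ^+ n)) => // n.
by apply: finite_measure_integrable_cst.
Qed.

Lemma finite_momentsZ (c : R[i]) f : finite_moments f ->
  finite_moments (fun w => c * f w).
Proof. by apply: finite_momentsM; exact: finite_moments_cst. Qed.

Lemma finite_moments_sum (I : Type) (r : seq I) (p : pred I)
    (F : I -> T -> R[i]) :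
  (forall i, finite_moments (F i)) ->
  finite_moments (fun w => \sum_(i <- r | p i) F i w).
Proof.
move=> fmF; elim: r => [|i r IH].
  by under eq_fun do rewrite big_nil; exact: finite_moments_cst.
under eq_fun do rewrite big_cons; case: (p i) => //.
exact: finite_momentsD.
Qed.

Lemma finite_moments_prod (I : Type) (r : seq I) (p : pred I)
    (F : I -> T -> R[i]) :
  (forall i, finite_moments (F i)) ->
  finite_moments (fun w => \prod_(i <- r | p i) F i w).
Proof.
move=> fmF; elim: r => [|i r IH].
  by under eq_fun do rewrite big_nil; exact: finite_moments_cst.
under eq_fun do rewrite big_cons; case: (p i) => //.
exact: finite_momentsM.
Qed.

Lemma finite_momentsX f n : finite_moments f ->
  finite_moments (fun w => f w ^+ n).
Proof.
move=> fmf; elim: n => [|n IH].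
  by under eq_fun do rewrite expr0; exact: finite_moments_cst.
by under eq_fun do rewrite exprS; exact: finite_momentsM.
Qed.

Lemma integrable_Re f : finite_moments f ->
  P.-integrable setT (EFin \o (fun w => complex.Re (f w))).
Proof.
move=> [mr mi /(_ 1)]; apply: (le_integrable measurableT).
  exact/measurable_EFinP.
move=> w _ /=; rewrite lee_fin expr1 (ger0_norm (modulus_ge0 _)).
exact: modulus_Re.
Qed.

Lemma integrable_Im f : finite_moments f ->
  P.-integrable setT (EFin \o (fun w => complex.Im (f w))).
Proof.
move=> [mr mi /(_ 1)]; apply: (le_integrable measurableT).
  exact/measurable_EFinP.
move=> w _ /=; rewrite lee_fin expr1 (ger0_norm (modulus_ge0 _)).
exact: modulus_Im.
Qed.

Lemma meanE (X : T -> R) : mean P X = (\int[P]_w X w)%R.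
Proof. by rewrite /mean unlock. Qed.

Lemma cmean_real (X : T -> R) : cmean P (fun w => (X w)%:C) = (mean P X)%:C.
Proof.
rewrite /cmean; congr (_ +i* _).
by rewrite meanE /= Rintegral_cst// mul0r.
Qed.

Lemma cmean_cst (c : R[i]) : cmean P (fun=> c) = c.
Proof.
rewrite /cmean !meanE !Rintegral_cst// [X in fine X]probability_setT !mulr1.
by case: c.
Qed.

Lemma cmeanD f g : finite_moments f -> finite_moments g ->
  cmean P (fun w => f w + g w) = cmean P f + cmean P g.
Proof.
move=> fmf fmg; rewrite /cmean !meanE /GRing.add/=; congr (_ +i* _).
- rewrite -RintegralD//; [|exact: integrable_Re..].
  by apply: eq_Rintegral => w _; case: (f w) (g w) => ? ? [].
- rewrite -RintegralD//; [|exact: integrable_Im..].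
  by apply: eq_Rintegral => w _; case: (f w) (g w) => ? ? [].
Qed.

Lemma cmeanZ (c : R[i]) f : finite_moments f ->
  cmean P (fun w => c * f w) = c * cmean P f.
Proof.
move=> fmf; have ir := integrable_Re fmf; have ii := integrable_Im fmf.
case: c => a b; rewrite /cmean !meanE /GRing.mul/=; congr (_ +i* _).
- rewrite -!RintegralZl// -RintegralB//.
  + by apply: eq_Rintegral => w _; case: (f w).
  + exact: (@integrableZl _ _ _ P _ measurableT a _ ir).
  + exact: (@integrableZl _ _ _ P _ measurableT b _ ii).
- rewrite -!RintegralZl// -RintegralD//.
  + by apply: eq_Rintegral => w _; case: (f w).
  + exact: (@integrableZl _ _ _ P _ measurableT a _ ii).
  + exact: (@integrableZl _ _ _ P _ measurableT b _ ir).
Qed.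

Lemma cmeanJ f : finite_moments f ->
  cmean P (fun w => (f w)^*%C) = (cmean P f)^*%C.
Proof.
move=> fmf; rewrite /cmean !meanE/=; congr (_ +i* _).
- by apply: eq_Rintegral => w _; case: (f w).
- rewrite -mulN1r -RintegralZl//; last exact: integrable_Im.
  by apply: eq_Rintegral => w _; case: (f w) => ? ? /=; rewrite mulN1r.
Qed.

Lemma cmean_sum (I : Type) (r : seq I) (p : pred I) (F : I -> T -> R[i]) :
  (forall i, finite_moments (F i)) ->
  cmean P (fun w => \sum_(i <- r | p i) F i w) =
  \sum_(i <- r | p i) cmean P (F i).
Proof.
move=> fmF; elim: r => [|i r IH].
  by under eq_fun do rewrite big_nil; rewrite cmean_cst big_nil.
rewrite big_cons; under eq_fun do rewrite big_cons; case: (p i) => //.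
by rewrite cmeanD// ?IH//; exact: finite_moments_sum.
Qed.

End FiniteMoments.

(** * Expectations of products of independent variables *)

Section Independence.
Context {d d' : measure_display} {T : measurableType d} {U : measurableType d'}
  {R : realType}.
Variables (P : probability T R) (I : finType) (X : I -> T -> U).
Hypothesis mX : forall i, measurable_fun setT (X i).
Hypothesis indepX : mutually_independent P X.
Local Open Scope complex_scope.

Lemma prod_indic (A : I -> set U) w :
  \prod_i (\1_(A i) (X i w) : R) =
  \1_(\bigcap_(i in [set` [set: I]%SET]) (X i @^-1` A i)) w.
Proof.
rewrite [RHS]indicE; case: (boolP (w \in _)) => [|/negP nA].
  rewrite inE => wA; rewrite big1// => i _; rewrite indicE.
  by rewrite mem_set//; apply: wA; rewrite /= inE.
have [i niA] : exists i, ~ A i (X i w).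
  apply: contrapT => /forallNP h; apply: nA; rewrite inE => i _.
  exact: contrapT (h i).
by rewrite (bigD1 i)//= indicE memNset// mul0r.
Qed.

(* The functions are freed one index at a time from being indicators: the
   product of the others is the density of a measure proportional to the law of
   the variable with that index. *)
Lemma ge0_integral_prod (f : I -> U -> R) :
  (forall i, measurable_fun setT (f i)) ->
  (forall i u, 0 <= f i u) ->
  (forall i, P.-integrable setT (EFin \o (f i \o X i))) ->
  (\int[P]_w (\prod_i f i (X i w))%:E = (\prod_i mean P (f i \o X i))%:E)%E.
Proof.
(* Induction on the size of [K], the set of indices whose function may fail to be an indicator. With
   [K] empty the claim is the definition of independence. *)
suff h (n : nat) (K : {set I}) (f' : I -> U -> R) : (#|K| <= n)%N ->
    (forall i, measurable_fun setT (f' i)) ->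
    (forall i u, 0 <= f' i u) ->
    (forall i, P.-integrable setT (EFin \o (f' i \o X i))) ->
    (forall i, i \notin K -> exists2 A, measurable A & f' i = \1_A) ->
    (\int[P]_w (\prod_i f' i (X i w))%:E =
     (\prod_i mean P (f' i \o X i))%:E)%E.
  move=> mf f0 fi; apply: (h _ [set: I]%SET _ (leqnn _)) => // i.
  by rewrite finset.in_setT.
have mpre i A : measurable A -> measurable (X i @^-1` A).
  by move=> mA; rewrite -[X in measurable X]setTI; exact: mX.
have indic_comp i A : (\1_A : U -> R) \o X i = \1_(X i @^-1` A).
  by apply/funext => w; rewrite /= !indicE.
have mean_indic i A : measurable A ->
    (mean P (\1_A \o X i))%:E = P (X i @^-1` A).
  move=> mA; rewrite indic_comp /mean expectation_indic ?fineK//.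
    by apply: fin_num_measure; exact: mpre.
  exact: mpre.
elim: n K f' => [|n IH] K f' Kn mf f0 fi fK.
  have K0 i : i \notin K.
    by move: Kn; rewrite leqn0 cards_eq0 => /eqP ->; rewrite inE.
  have /choice[A HA] : forall i, exists A, measurable A /\ f' i = \1_A.
    by move=> i; have [A mA fA] := fK i (K0 i); exists A.
  have mXA i : measurable (X i @^-1` A i) by exact: mpre (HA i).1.
  under eq_integral => w _.
    rewrite (_ : \prod_i _ = \prod_i (\1_(A i) (X i w) : R)); last first.
      by apply: eq_bigr => i _; rewrite (HA i).2.
    rewrite prod_indic.
    over.
  rewrite integral_indic// ?setIT; last first.
    by apply: fin_bigcap_measurable => //; exact: finite_finset.
  apply: (etrans (@indepX [set: I]%SET A (fun i => (HA i).1))).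
  rewrite (big_morph EFin (@EFinM R) (erefl _)); apply: eq_big => [i|i _].
    by rewrite finset.in_setT.
  by rewrite (HA i).2 mean_indic//; case: (HA i).
have [K0|[i iK]] := set_0Vmem K.
  by apply: (IH K) => //; rewrite K0 cards0.
pose c := \prod_(j | j != i) mean P (f' j \o X j).
pose W w := \prod_(j | j != i) f' j (X j w).
have c0 : 0 <= c.
  apply: prodr_ge0 => j _; rewrite meanE Rintegral_ge0// => w _.
  exact: f0.
have W0 w : 0 <= W w by apply: prodr_ge0 => j _; exact: f0.
have mW : measurable_fun setT W.
  rewrite /W; under eq_fun do rewrite -big_filter.
  by apply: measurable_prod => j _; exact: measurableT_comp.
pose push :=
  measure_function_pushforward__canonical__measure_function_Measure P (mX i).
pose nu := mscale (NngNum c0) push.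
have dens A : measurable A ->
    (\int[P]_w ((\1_A (X i w))%:E * (W w)%:E) = nu A)%E.
  (* Putting an indicator at [i] removes [i] from [K], so the induction hypothesis computes the
     density integral. *)
  move=> mA; pose fA j := if j == i then (\1_A : U -> R) else f' j.
  have fAi : fA i = \1_A by rewrite /fA eqxx.
  have fAj j : j != i -> fA j = f' j by rewrite /fA => /negbTE ->.
  have := IH (K :\ i)%SET fA; rewrite (bigD1 i)//= fAi.
  have -> : \prod_(j | j != i) mean P (fA j \o X j) = c.
    by apply: eq_bigr => j ji; rewrite fAj.
  rewrite EFinM mean_indic//.
  move=> IHA; transitivity (\int[P]_w (\prod_j fA j (X j w))%:E)%E.
    apply: eq_integral => w _; rewrite -EFinM (bigD1 i)//= fAi.
    congr (_ * _)%:E; apply: eq_bigr => j ji; by rewrite fAj.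
  rewrite IHA; first by rewrite /nu /mscale /= muleC.
  - by rewrite (cardsD1 i) iK in Kn.
  - move=> j; rewrite /fA; case: ifP => // _; exact: measurable_indic.
  - move=> j u; rewrite /fA; case: ifP => // _.
  - move=> j; have [->|ji] := eqVneq j i; last by rewrite fAj.
    rewrite fAi indic_comp; apply: integrable_indic; exact: mpre.
  - move=> j; rewrite in_setD1 negb_and negbK; have [->|ji] := eqVneq j i.
      by move=> _; exists A.
    by rewrite fAj//=; exact: fK.
rewrite (bigD1 i)//= -/c.
transitivity (\int[P]_w ((f' i (X i w))%:E * (W w)%:E))%E.
  by apply: eq_integral => w _; rewrite -EFinM (bigD1 i).
have mfi : measurable_fun setT (EFin \o f' i) by exact/measurable_EFinP.
rewrite (@ge0_integral_density _ _ _ _ _ P nu (X i) W _ mW W0 dens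
  (EFin \o f' i))//; last first.
  by move=> u; rewrite lee_fin.
rewrite ge0_integral_mscale//; last by move=> u _; rewrite lee_fin.
rewrite ge0_integral_pushforward//; last by move=> u _; rewrite lee_fin.
rewrite preimage_setT EFinM muleC; congr (_ * _)%E.
rewrite meanE fineK//; exact: integrable_fin_num (fi i).
Qed.

(* Every factor is a combination of nonnegative functions, so that
   multilinearity reduces the statement to [ge0_integral_prod]. *)
Lemma cmean_prod (f : I -> U -> R[i]) :
  (forall i, measurable_fun setT (fun u => complex.Re (f i u))) ->
  (forall i, measurable_fun setT (fun u => complex.Im (f i u))) ->
  (forall i, finite_moments P (f i \o X i)) ->
  cmean P (fun w => \prod_i f i (X i w)) = \prod_i cmean P (f i \o X i).
Proof.
(* Here [K] holds the indices whose factor may fail to be nonnegative. In [R[i]] being nonnegative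
   includes being real, so the base case is the real statement. *)
suff h (n : nat) (K : {set I}) (f' : I -> U -> R[i]) : (#|K| <= n)%N ->
    (forall i, measurable_fun setT (fun u => complex.Re (f' i u))) ->
    (forall i, measurable_fun setT (fun u => complex.Im (f' i u))) ->
    (forall i, finite_moments P (f' i \o X i)) ->
    (forall i, i \notin K -> forall u, 0 <= f' i u) ->
    cmean P (fun w => \prod_i f' i (X i w)) = \prod_i cmean P (f' i \o X i).
  move=> mr mi fm; apply: (h _ [set: I]%SET _ (leqnn _)) => // i.
  by rewrite finset.in_setT.
elim: n K f' => [|n IH] K f' Kn mr mi fm fK.
  have K0 i : i \notin K.
    by move: Kn; rewrite leqn0 cards_eq0 => /eqP ->; rewrite inE.
  pose g i u := complex.Re (f' i u).
  have fg i u : f' i u = (g i u)%:C.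
    by rewrite RRe_real// ger0_real// fK.
  have g0 i u : 0 <= g i u by rewrite -ler0c -fg fK.
  under eq_fun => w.
    rewrite (_ : \prod_i _ = (\prod_i g i (X i w))%:C); last first.
      by rewrite rmorph_prod; apply: eq_bigr.
    over.
  rewrite cmean_real /mean unlock ge0_integral_prod//=; last first.
    by move=> i; exact: integrable_Re (fm i).
  rewrite rmorph_prod; apply: eq_bigr => i _ /=.
  by rewrite -cmean_real; congr cmean; apply/funext => w; rewrite /= fg.
have [K0|[i iK]] := set_0Vmem K.
  by apply: (IH K) => //; rewrite K0 cards0.
(* Factor [i] is split into the positive and negative parts of its real and imaginary parts. Each is
   bounded by the modulus of the factor and so inherits finite moments. *)
pose c (l : 'I_4) : R[i] := [:: 1; -1; 'i; - 'i]`_l.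
pose g (l : 'I_4) u : R := [:: Num.max (complex.Re (f' i u)) 0;
  Num.max (- complex.Re (f' i u)) 0;
  Num.max (complex.Im (f' i u)) 0; Num.max (- complex.Im (f' i u)) 0]`_l.
have fE u : f' i u = \sum_l c l * (g l u)%:C.
  rewrite !big_ord_recl big_ord0 /c /g /= addr0.
  case: (f' i u) => a b /=.
  have hm (x : R) : x = Num.max x 0 - Num.max (- x) 0.
    by case: (leP x 0) => h; case: (leP (- x) 0) => h'; lra.
  rewrite {1}(hm a) {1}(hm b).
  move: (Num.max a 0) (Num.max (- a) 0) (Num.max b 0) (Num.max (- b) 0).
  move=> a1 a2 b1 b2; apply/eqP; rewrite eq_complex /=.
  by apply/andP; split; apply/eqP; ring.
have g0 l u : 0 <= g l u.
  by rewrite /g; case: l => [[|[|[|[|]]]]] //= _; rewrite le_max lexx orbT.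
have mg l : measurable_fun setT (g l).
  rewrite /g; case: l => [[|[|[|[|]]]]] //= _; apply: measurable_maxr => //;
    exact: measurableT_comp.
have gf l u : modulus (g l u)%:C <= modulus (f' i u).
  rewrite modulus_real ger0_norm//.
  have := modulus_Re (f' i u); have := modulus_Im (f' i u).
  rewrite !ler_norml => /andP[h1 h2] /andP[h3 h4].
  rewrite /g; case: l => [[|[|[|[|]]]]] //= _; rewrite ge_max modulus_ge0 andbT//.
    by rewrite lerNl.
  by rewrite lerNl.
pose f'' l j u := if j == i then (g l u)%:C else f' j u.
have fi'' l : f'' l i = fun u => (g l u)%:C by rewrite /f'' eqxx.
have fj'' l j : j != i -> f'' l j = f' j by rewrite /f'' => /negbTE ->.
have fmg l : finite_moments P (fun w => (g l (X i w))%:C).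
  apply: finite_moments_dom (fm i) => //=.
  exact: measurableT_comp.
have fm'' l j : finite_moments P (f'' l j \o X j).
  have [->|ji] := eqVneq j i; last by rewrite fj''.
  by rewrite fi''; exact: fmg.
have E w : \prod_j f' j (X j w) = \sum_l c l * \prod_j f'' l j (X j w).
  rewrite (bigD1 i)//= fE mulr_suml; apply: eq_bigr => l _.
  rewrite -mulrA [in RHS](bigD1 i)//= fi''; congr (_ * (_ * _)).
  by apply: eq_bigr => j ji; rewrite fj''.
have -> : cmean P (fun w => \prod_j f' j (X j w)) =
    \sum_l c l * \prod_j cmean P (f'' l j \o X j).
  under eq_fun do rewrite E.
  have fmp l : finite_moments P (fun w => \prod_j f'' l j (X j w)).
    by apply: finite_moments_prod => j; exact: fm''.
  rewrite cmean_sum; last by move=> l; exact: finite_momentsZ.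
  apply: eq_bigr => l _; rewrite cmeanZ//; congr (_ * _).
  apply: (IH (K :\ i)%SET) => //.
  - by rewrite (cardsD1 i) iK in Kn.
  - move=> j; have [->|ji] := eqVneq j i; last by rewrite fj''.
    by rewrite fi''; exact: mg.
  - move=> j; have [->|ji] := eqVneq j i; last by rewrite fj''.
    by rewrite fi''; exact: measurable_cst.
  - move=> j; rewrite in_setD1 negb_and negbK; have [-> _ u|ji] := eqVneq j i.
      by rewrite fi'' ler0c.
    by rewrite fj''//=; exact: fK.
rewrite [RHS](bigD1 i)//=.
have -> : f' i \o X i = (fun w => \sum_l c l * (g l (X i w))%:C).
  by apply/funext => w /=; rewrite fE.
rewrite cmean_sum; last by move=> l; exact: finite_momentsZ.
rewrite mulr_suml; apply: eq_bigr => l _; rewrite cmeanZ// -mulrA.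
rewrite (bigD1 i)//= fi''; congr (_ * (_ * _)).
by apply: eq_bigr => j ji; rewrite fj''.
Qed.

End Independence.

(** * Moments of complex Gaussian families *)

Section ComplexGaussian.
Context {d : measure_display} {T : measurableType d} {R : realType}.
Variables (P : probability T R) (Z : T -> R[i]).
Hypothesis ZN : std_complex_gaussian P Z.
Local Open Scope complex_scope.
Local Notation halfN := (normal_prob (0 : R) (Num.sqrt 2^-1)).

(** Indexing by [bool] makes the two parts a finite family, to which [mutually_independent] and
    [cmean_prod] apply. *)
Definition part (b : bool) (w : T) : measurableTypeR R :=
  if b then complex.Re (Z w) else complex.Im (Z w).

Lemma measurable_part b : measurable_fun setT (part b).
Proof.
have [mZ _] := ZN; case: b.
- exact: (@measurableT_comp _ _ _ _ _ _ fst _ (re_im Z)).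
- exact: (@measurableT_comp _ _ _ _ _ _ snd _ (re_im Z)).
Qed.

Lemma parts_law (A : bool -> set (measurableTypeR R)) :
  (forall b, measurable (A b)) ->
  P (part true @^-1` A true `&` part false @^-1` A false) =
  (halfN (A true) * halfN (A false))%E.
Proof.
move=> mA; have [_ lawZ] := ZN.
have := lawZ (A true `*` A false) (measurableX (mA true) (mA false)).
by rewrite product_measure1E.
Qed.

Lemma part_law b (A : set (measurableTypeR R)) : measurable A ->
  P (part b @^-1` A) = halfN A.
Proof.
move=> mA; have N1 : halfN setT = 1%E by exact: probability_setT.
case: b.
- have := @parts_law (fun b => if b then A else setT).
  rewrite preimage_setT setIT N1 mule1; apply; by case.
- have := @parts_law (fun b => if b then setT else A).
  rewrite preimage_setT setTI N1 mul1e; apply; by case.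
Qed.

Lemma parts_indep : mutually_independent P part.
Proof.
(* Full space at the indices outside [J] reduces every subfamily to the law of the pair. *)
move=> J A mA; pose B b := if b \in J then A b else setT.
have mB b : measurable (B b) by rewrite /B; case: ifP.
transitivity (\prod_(b : bool) P (part b @^-1` (B b)))%E.
  rewrite big_bool /= !part_law// -parts_law//; congr (P _).
  apply/seteqP; split=> w.
    by move=> h; split; rewrite /B /=; case: ifP => // bJ; exact: h.
  move=> [h1 h2] [] bJ.
    by move: h1; rewrite /B /= bJ.
  by move: h2; rewrite /B /= bJ.
rewrite [RHS]big_mkcond; apply: eq_bigr => b _; rewrite /B; case: ifP => // _.
by rewrite preimage_setT probability_setT.
Qed.

Lemma part_density b (A : set (measurableTypeR R)) : measurable A ->
  (\int[P]_w ((\1_A (part b w))%:E * 1%:E) = halfN A)%E.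
Proof.
move=> mA; have mbA : measurable (part b @^-1` A).
  by rewrite -[X in measurable X]setTI; exact: measurable_part.
rewrite -(part_law b mA) -[X in P X]setIT -integral_indic//.
by apply: eq_integral => w _; rewrite mule1 /= !indicE.
Qed.

Lemma integral_part b (f : measurableTypeR R -> R) : measurable_fun setT f ->
  (\int[P]_w (f (part b w))%:E = \int[halfN]_x (f x)%:E)%E.
Proof.
move=> mf; rewrite -(@integral_density _ _ _ _ R P halfN (part b) (cst 1)
  (measurable_part b) _ _ (@part_density b) f)//.
by under [RHS]eq_integral do rewrite mulr1.
Qed.

Lemma finite_moments_part b : finite_moments P (fun w => (part b w)%:C).
Proof.
have mp := measurable_part b.
split => // n.
have mX : measurable_fun setT (fun x : R => `|x| ^+ n).
  by apply: measurable_funX; exact: normr_measurable.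
under eq_fun do rewrite modulus_real.
apply/integrableP; split.
  apply/measurable_EFinP.
  exact: (@measurableT_comp _ _ _ _ _ _ (fun x : R => `|x| ^+ n)).
under eq_integral do rewrite /= ger0_norm ?exprn_ge0//.
rewrite (@integral_part b (fun x => `|x| ^+ n))//.
have [/integrableP[_ +] _] := @halfN_moment R n.
by under eq_integral do rewrite /= normrX.
Qed.

Lemma cmean_parts a b :
  cmean P (fun w => (complex.Re (Z w) ^+ a * complex.Im (Z w) ^+ b)%:C) =
  (@halfN_mom R a * @halfN_mom R b)%:C.
Proof.
pose f (c : bool) (x : measurableTypeR R) : R[i] := (x ^+ (if c then a else b))%:C.
have mf k : measurable_fun setT (fun x : measurableTypeR R => x ^+ k).
  exact: exprn_measurable.
have := @cmean_prod _ _ _ _ R P bool part (@measurable_part) parts_indep f _ _ _.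
rewrite big_bool; under eq_fun do rewrite big_bool.
rewrite /f /= => E; under eq_fun do rewrite rmorphM.
rewrite E.
- rewrite rmorphM; congr (_ * _).
  + rewrite (_ : _ \o _ = (fun w => (part true w ^+ a)%:C))// cmean_real.
    rewrite meanE /Rintegral (@integral_part true (fun x => x ^+ a))//.
  + rewrite (_ : _ \o _ = (fun w => (part false w ^+ b)%:C))// cmean_real.
    rewrite meanE /Rintegral (@integral_part false (fun x => x ^+ b))//.
- by case; exact: mf.
- by move=> _; exact: measurable_cst.
- move=> c; have := finite_momentsX (if c then a else b) (finite_moments_part c).
  by under eq_fun do rewrite -rmorphXn.
Qed.

Lemma finite_moments_gaussian : finite_moments P Z.
Proof.
have := finite_momentsD (finite_moments_part true)
  (finite_momentsZ 'i (finite_moments_part false)).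
by under eq_fun do rewrite -complexE.
Qed.

Lemma cmean_parts_sum (s : seq (R[i] * (nat * nat))) :
  cmean P (fun w => \sum_(t <- s) t.1 *
    (complex.Re (Z w) ^+ t.2.1 * complex.Im (Z w) ^+ t.2.2)%:C) =
  \sum_(t <- s) t.1 * (@halfN_mom R t.2.1 * @halfN_mom R t.2.2)%:C.
Proof.
have fm t : finite_moments P (fun w =>
    (complex.Re (Z w) ^+ t.1 * complex.Im (Z w) ^+ t.2)%:C).
  under eq_fun do rewrite rmorphM !rmorphXn.
  apply: finite_momentsM; apply: finite_momentsX.
    exact: finite_moments_part true.
  exact: finite_moments_part false.
rewrite cmean_sum; last by move=> t; exact/finite_momentsZ/fm.
by apply: eq_bigr => t _; rewrite cmeanZ// cmean_parts.
Qed.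

(** A polynomial in the real and imaginary parts is encoded as a list of a coefficient with its two
    exponents; its mean is then read off the real moments. *)
Lemma cmean_by_parts (f : T -> R[i]) (s : seq (R[i] * (nat * nat))) :
  (forall w, f w = \sum_(t <- s) t.1 *
    (complex.Re (Z w) ^+ t.2.1 * complex.Im (Z w) ^+ t.2.2)%:C) ->
  cmean P f = \sum_(t <- s) t.1 * (@halfN_mom R t.2.1 * @halfN_mom R t.2.2)%:C.
Proof.
move=> fE; rewrite -cmean_parts_sum; congr cmean.
by apply/funext => w; rewrite fE.
Qed.

(** For a = b = 2, x^4 + 2 x^2 y^2 + y^4 has mean 3/4 + 2/4 + 3/4 = 2!. The unequal cases vanish
    through odd moments or, for Z^2, because both parts have the same variance. Exponents up to 2
    suffice for fourth moments with two conjugated factors. *)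
Lemma cmean_gaussian_le (a b : nat) : (b <= a)%N -> (a <= 2)%N ->
  cmean P (fun w => Z w ^+ a * (Z w)^*%C ^+ b) =
  (if a == b then a`! else 0)%N%:R.
Proof.
have mE := (@halfN_mom0 R, @halfN_mom1 R, @halfN_momSS R).
case: a => [|[|[|//]]]; case: b => [|[|[|//]]] // _ _.
- under eq_fun do rewrite !expr0 mul1r; exact: cmean_cst.
- rewrite (@cmean_by_parts _ [:: (1, (1, 0)%N); ('i%C, (0, 1)%N)]).
    rewrite !big_cons big_nil /= !mE.
    apply/eqP; rewrite eq_complex /=; apply/andP; split; apply/eqP; ring.
  move=> w; rewrite !big_cons big_nil /=; case: (Z w) => x y /=.
  rewrite ?expr0 ?expr1 ?expr2.
  apply/eqP; rewrite eq_complex /=; apply/andP; split; apply/eqP; ring.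
- rewrite (@cmean_by_parts _ [:: (1, (2, 0)%N); (1, (0, 2)%N)]).
    rewrite !big_cons big_nil /= !mE.
    by apply/eqP; rewrite eq_complex /=; apply/andP; split; apply/eqP; field.
  move=> w; rewrite !big_cons big_nil /=; case: (Z w) => x y /=.
  rewrite ?expr0 ?expr1 ?expr2.
  apply/eqP; rewrite eq_complex /=; apply/andP; split; apply/eqP; ring.
- rewrite (@cmean_by_parts _ [:: (1, (2, 0)%N); (-1, (0, 2)%N);
     (2 * 'i%C, (1, 1)%N)]).
    rewrite !big_cons big_nil /= !mE.
    by apply/eqP; rewrite eq_complex /=; apply/andP; split; apply/eqP; field.
  move=> w; rewrite !big_cons big_nil /=; case: (Z w) => x y /=.
  rewrite ?expr0 ?expr1 ?expr2.
  apply/eqP; rewrite eq_complex /=; apply/andP; split; apply/eqP; ring.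
- rewrite (@cmean_by_parts _ [:: (1, (3, 0)%N); (1, (1, 2)%N);
     ('i%C, (2, 1)%N); ('i%C, (0, 3)%N)]).
    rewrite !big_cons big_nil /= !mE.
    by apply/eqP; rewrite eq_complex /=; apply/andP; split; apply/eqP; field.
  move=> w; rewrite !big_cons big_nil /=; case: (Z w) => x y /=.
  rewrite ?expr0 ?expr1 ?expr2.
  apply/eqP; rewrite eq_complex /=; apply/andP; split; apply/eqP; ring.
- rewrite (@cmean_by_parts _ [:: (1, (4, 0)%N); (2, (2, 2)%N); (1, (0, 4)%N)]).
    rewrite !big_cons big_nil /= !mE.
    by apply/eqP; rewrite eq_complex /=; apply/andP; split; apply/eqP; field.
  move=> w; rewrite !big_cons big_nil /=; case: (Z w) => x y /=.
  rewrite ?expr0 ?expr1 ?expr2.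
  apply/eqP; rewrite eq_complex /=; apply/andP; split; apply/eqP; ring.
Qed.

(** Conjugation exchanges the exponents, and the value is real. *)
Lemma cmean_gaussian (a b : nat) : (a <= 2)%N -> (b <= 2)%N ->
  cmean P (fun w => Z w ^+ a * (Z w)^*%C ^+ b) =
  (if a == b then a`! else 0)%N%:R.
Proof.
move=> a2 b2; have [ba|/ltnW ab] := leqP b a; first exact: cmean_gaussian_le.
have fm : finite_moments P (fun w => Z w ^+ b * (Z w)^*%C ^+ a).
  apply: finite_momentsM; apply: finite_momentsX.
    exact: finite_moments_gaussian.
  exact/finite_momentsJ/finite_moments_gaussian.
rewrite -[LHS]conjcK -cmeanJ.
  under eq_fun do rewrite rmorphM !rmorphXn /= conjcK mulrC.
  rewrite cmean_gaussian_le// conjc_nat eq_sym.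
  by case: eqVneq => // ->.
apply: finite_momentsM; apply: finite_momentsX.
  exact: finite_moments_gaussian.
exact/finite_momentsJ/finite_moments_gaussian.
Qed.

End ComplexGaussian.

Lemma prod_count_mem (R : comNzRingType) (I : finType) (s : seq I) (F : I -> R) :
  \prod_(x <- s) F x = \prod_x F x ^+ count_mem x s.
Proof.
elim: s => [|y s IH]; first by rewrite big_nil big1.
rewrite big_cons IH [in RHS](bigD1 y)//= eqxx exprS -mulrA.
rewrite [in LHS](bigD1 y)//=; congr (_ * (_ * _)).
by apply: eq_bigr => x xy; rewrite eq_sym (negbTE xy).
Qed.

(** * Mixed moments of independent CN(0,1) variables *)

Section Isserlis.
Context {d : measure_display} {T : measurableType d} {R : realType}.
Variables (P : probability T R) (I : finType) (Z : I -> T -> R[i]).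
Hypothesis indepZ : mutually_independent P (fun i => re_im (Z i)).
Hypothesis ZN : forall i, std_complex_gaussian P (Z i).
Local Open Scope complex_scope.

Lemma cmean_monomial (a b : I -> nat) :
  (forall i, a i <= 2)%N -> (forall i, b i <= 2)%N ->
  cmean P (fun w => \prod_i (Z i w ^+ a i * (Z i w)^*%C ^+ b i)) =
  \prod_i (if a i == b i then (a i)`! else 0)%N%:R.
Proof.
move=> a2 b2.
(* Independence concerns the real pairs [re_im (Z i)], so each factor is rewritten as a function of
   such a pair. *)
pose f i (u : measurableTypeR R * measurableTypeR R) : R[i] :=
  (u.1 +i* u.2) ^+ a i * (u.1 -i* u.2) ^+ b i.
have ZE i w : Z i w ^+ a i * (Z i w)^*%C ^+ b i = f i (re_im (Z i) w).
  by rewrite /f /=; case: (Z i w).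
have fmZ i := finite_moments_gaussian (ZN i).
have mZ i : measurable_fun setT (re_im (Z i)) by case: (ZN i).
have mf i : complex_measurable (f i).
  apply: complex_measurableM; apply: complex_measurableX; split.
  - exact: measurable_fst.
  - exact: measurable_snd.
  - exact: measurable_fst.
  - by apply: measurableT_comp; last exact: measurable_snd.
under eq_fun => w.
  rewrite (_ : \prod_i _ = \prod_i f i (re_im (Z i) w)); last first.
    by apply: eq_bigr => i _; exact: ZE.
  over.
rewrite (cmean_prod mZ indepZ).
- apply: eq_bigr => i _; rewrite -(cmean_gaussian (ZN i))//.
  by congr cmean; apply/funext => w; rewrite ZE.
- by move=> i; case: (mf i).
- by move=> i; case: (mf i).
- move=> i; rewrite (_ : _ \o _ = fun w => Z i w ^+ a i * (Z i w)^*%C ^+ b i).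
    by apply: finite_momentsM; apply: finite_momentsX => //; exact: finite_momentsJ.
  by apply/funext => w; rewrite ZE.
Qed.

(** Grouping equal indices gives a monomial whose exponents are the multiplicities in [s] and [t];
    an index with different multiplicities contributes a zero factor. All the low-order moments
    below are instances. *)
Lemma cmean_seq (s t : seq I) : (size s <= 2)%N -> (size t <= 2)%N ->
  cmean P (fun w => \prod_(i <- s) Z i w * \prod_(j <- t) (Z j w)^*%C) =
  if perm_eq s t then \prod_i ((count_mem i s)`!)%:R else 0.
Proof.
move=> s2 t2.
have E w : \prod_(i <- s) Z i w * \prod_(j <- t) (Z j w)^*%C =
    \prod_i (Z i w ^+ count_mem i s * (Z i w)^*%C ^+ count_mem i t).
  by rewrite (prod_count_mem s) (prod_count_mem t) -big_split.
under eq_fun do rewrite E.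
rewrite cmean_monomial; last 2 first.
- by move=> i; rewrite (leq_trans (count_size _ _)).
- by move=> i; rewrite (leq_trans (count_size _ _)).
case: ifPn => [/permP st|].
  by apply: eq_bigr => i _; rewrite st eqxx.
rewrite /perm_eq => /allPn[i _ /= ist].
by rewrite (bigD1 i)//= (negbTE ist) mul0r.
Qed.

Lemma cmean_Z i : cmean P (Z i) = 0.
Proof.
have := @cmean_seq [:: i] [::] isT isT.
under eq_fun do rewrite big_seq1 big_nil mulr1.
by move=> ->; case: ifP => // /perm_size.
Qed.

Lemma cmean_ZZ i j : cmean P (fun w => Z i w * Z j w) = 0.
Proof.
have := @cmean_seq [:: i; j] [::] isT isT.
under eq_fun do rewrite !big_cons !big_nil !mulr1.
by move=> ->; case: ifP => // /perm_size.
Qed.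

Lemma cmean_ZJ i j : cmean P (fun w => Z i w * (Z j w)^*%C) = (i == j)%:R.
Proof.
have := @cmean_seq [:: i] [:: j] isT isT.
under eq_fun do rewrite !big_seq1.
move=> ->; have [->|ij] := eqVneq i j.
  rewrite perm_refl big1// => k _ /=.
  by case: eqP.
case: ifP => // /perm_mem/(_ i); rewrite !inE eqxx => /esym ij'.
by rewrite ij' in ij.
Qed.

Lemma cmean_ZZJ i j k : cmean P (fun w => Z i w * Z j w * (Z k w)^*%C) = 0.
Proof.
have := @cmean_seq [:: i; j] [:: k] isT isT.
under eq_fun do rewrite !big_cons !big_nil !mulr1.
by move=> ->; case: ifP => // /perm_size.
Qed.

(** If i = k, both pairings hold or fail together and 2! counts them both; if i and k differ, the
    factorials are 1 and at most one pairing holds. *)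
Lemma cmean_ZZJJ i j k l :
  cmean P (fun w => Z i w * Z k w * ((Z j w)^*%C * (Z l w)^*%C)) =
  ((i == j) && (k == l))%:R + ((i == l) && (k == j))%:R.
Proof.
have := @cmean_seq [:: i; k] [:: j; l] isT isT.
under eq_fun do rewrite !big_cons !big_nil !mulr1.
move=> ->.
have [<-{k}|ik] := eqVneq i k.
  have [<-{j}|ij] := eqVneq i j; have [<-{l}|il] := eqVneq i l => //=.
  - rewrite perm_refl (bigD1 i)//= eqxx /= big1 ?mulr1 ?natrD//.
    by move=> k ki; rewrite eq_sym (negbTE ki).
  - case: ifP => [/perm_mem/(_ l)|_]; last by rewrite add0r.
    by rewrite !inE eqxx eq_sym (negbTE il) orbT.
  - case: ifP => [/perm_mem/(_ j)|_]; last by rewrite add0r.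
    by rewrite !inE eqxx eq_sym (negbTE ij).
  - case: ifP => [/perm_mem/(_ i)|_]; last by rewrite add0r.
    by rewrite !inE eqxx (negbTE ij) (negbTE il).
have -> : \prod_x ((count_mem x [:: i; k])`!)%:R = 1 :> R[i].
  rewrite big1// => x _ /=; rewrite addn0.
  case: eqVneq => [<-|_]; first by rewrite eq_sym (negbTE ik).
  by case: eqP.
have -> : perm_eq [:: i; k] [:: j; l] =
    ((i == j) && (k == l)) || ((i == l) && (k == j)).
  apply/idP/idP; last first.
    case/orP => /andP[/eqP -> /eqP ->]; first exact: perm_refl.
    by rewrite -[[:: l; j]]cat1s perm_catC.
  move=> h; have := perm_mem h i; have := perm_mem h k.
  rewrite !inE !eqxx orbT => /esym/orP[]/eqP hk /esym/orP[]/eqP hi.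
  - by rewrite hi hk eqxx in ik.
  - by rewrite -hi -hk !eqxx orbT.
  - by rewrite -hi -hk !eqxx.
  - by rewrite hi hk eqxx in ik.
have [ij|ij] := eqVneq i j; have [kl|kl] := eqVneq k l => //=.
- by rewrite -ij (eq_sym k) (negbTE ik) andbF addr0.
- by rewrite -ij (eq_sym k) (negbTE ik) andbF addr0.
- by rewrite -kl (negbTE ik) addr0.
- by rewrite add0r; case: ifP.
Qed.

End Isserlis.

Lemma sum_delta (R : comNzRingType) (I : finType) (k : I) (F : I -> R) :
  \sum_l F l * (k == l)%:R = F k.
Proof.
rewrite (bigD1 k)//= eqxx mulr1 big1 ?addr0// => l lk.
by rewrite eq_sym (negbTE lk) mulr0.
Qed.

(** * Moments of linear and affine forms in the Gaussian variables *)

Section LinearForms.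
Context {d : measure_display} {T : measurableType d} {R : realType}.
Variables (P : probability T R) (I : finType) (Z : I -> T -> R[i]).
Hypothesis indepZ : mutually_independent P (fun i => re_im (Z i)).
Hypothesis ZN : forall i, std_complex_gaussian P (Z i).
Local Open Scope complex_scope.
Implicit Types u v : I -> R[i].

Definition lin u w : R[i] := \sum_i u i * Z i w.

(** The covariance of [lin u] and [lin v], since the variables are orthonormal. *)
Definition inner u v : R[i] := \sum_i u i * (v i)^*%C.

Let fmZ i : finite_moments P (Z i) := finite_moments_gaussian (ZN i).

Lemma finite_moments_lin u : finite_moments P (lin u).
Proof. by apply: finite_moments_sum => i; exact: finite_momentsZ. Qed.

(** Peels one form off a product, the other factors staying packed in [G]; iterated, it reduces
    moments of forms to moments of the variables. *)
Lemma cmean_linM u (G : T -> R[i]) : finite_moments P G ->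
  cmean P (fun w => lin u w * G w) = \sum_i u i * cmean P (fun w => Z i w * G w).
Proof.
move=> fmG.
have E w : lin u w * G w = \sum_i u i * (Z i w * G w).
  by rewrite mulr_suml; apply: eq_bigr => i _; rewrite mulrA.
under eq_fun do rewrite E.
rewrite cmean_sum => [|i]; last exact/finite_momentsZ/finite_momentsM.
by apply: eq_bigr => i _; rewrite cmeanZ//; exact: finite_momentsM.
Qed.

Lemma cmean_linJM u (G : T -> R[i]) : finite_moments P G ->
  cmean P (fun w => (lin u w)^*%C * G w) =
  \sum_i (u i)^*%C * cmean P (fun w => (Z i w)^*%C * G w).
Proof.
move=> fmG.
have E w : (lin u w)^*%C * G w = \sum_i (u i)^*%C * ((Z i w)^*%C * G w).
  rewrite rmorph_sum mulr_suml; apply: eq_bigr => i _.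
  by rewrite rmorphM mulrA.
under eq_fun do rewrite E.
rewrite cmean_sum => [|i].
  apply: eq_bigr => i _; rewrite cmeanZ//.
  by apply: finite_momentsM => //; exact: finite_momentsJ.
by apply/finite_momentsZ/finite_momentsM => //; exact: finite_momentsJ.
Qed.

Lemma cmean_lin u : cmean P (lin u) = 0.
Proof.
rewrite /lin cmean_sum => [|i]; last exact: finite_momentsZ.
by rewrite big1// => i _; rewrite cmeanZ// (cmean_Z indepZ ZN) mulr0.
Qed.

Lemma cmean_lin2 u v : cmean P (fun w => lin u w * lin v w) = 0.
Proof.
rewrite cmean_linM ?big1//; last exact: finite_moments_lin.
move=> i _; under eq_fun do rewrite mulrC.
rewrite cmean_linM// big1 ?mulr0// => j _.
by rewrite (cmean_ZZ indepZ ZN) mulr0.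
Qed.

Lemma cmean_linJ u v : cmean P (fun w => lin u w * (lin v w)^*%C) = inner u v.
Proof.
rewrite cmean_linM; last exact/finite_momentsJ/finite_moments_lin.
apply: eq_bigr => i _; under eq_fun do rewrite mulrC.
rewrite cmean_linJM//; congr (_ * _).
under eq_bigr => j _.
  under eq_fun do rewrite mulrC.
  rewrite (cmean_ZJ indepZ ZN).
  over.
exact: (sum_delta i (fun j => (v j)^*%C)).
Qed.

Lemma cmean_lin2J u v x :
  cmean P (fun w => lin u w * lin v w * (lin x w)^*%C) = 0.
Proof.
have fml y := finite_moments_lin y.
under eq_fun do rewrite -mulrA.
rewrite cmean_linM ?big1//; last by apply/finite_momentsM/finite_momentsJ.
move=> i _; under eq_fun do rewrite mulrCA.
rewrite cmean_linM ?big1 ?mulr0//; last by apply/finite_momentsM/finite_momentsJ.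
move=> j _; under eq_fun do rewrite mulrA mulrC.
rewrite cmean_linJM ?big1 ?mulr0//; last exact/finite_momentsM.
by move=> k _; under eq_fun do rewrite mulrC; rewrite (cmean_ZZJ indepZ ZN) mulr0.
Qed.

Lemma cmean_lin2J2 u x v y :
  cmean P (fun w => lin u w * lin x w * ((lin v w)^*%C * (lin y w)^*%C)) =
  inner u v * inner x y + inner u y * inner x v.
Proof.
have fml z := finite_moments_lin z.
have fmlJ z := finite_momentsJ (fml z).
have fmZJ i := finite_momentsJ (fmZ i).
(* With two variables fixed, peeling the two conjugated forms leaves fourth moments whose Kronecker
   symbols collapse both sums. *)
have key i k :
    cmean P (fun w => Z k w * (Z i w * ((lin v w)^*%C * (lin y w)^*%C))) =
    (v i)^*%C * (y k)^*%C + (y i)^*%C * (v k)^*%C.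
  have -> : (fun w => Z k w * (Z i w * ((lin v w)^*%C * (lin y w)^*%C))) =
      (fun w => (lin v w)^*%C * ((lin y w)^*%C * (Z i w * Z k w))).
    by apply/funext => w; ring.
  rewrite cmean_linJM; last by do 2 apply: finite_momentsM => //.
  transitivity (\sum_j (v j)^*%C *
      ((i == j)%:R * (y k)^*%C + (k == j)%:R * (y i)^*%C)).
    apply: eq_bigr => j _; congr (_ * _).
    under eq_fun do rewrite mulrCA.
    rewrite cmean_linJM; last by do 2 apply: finite_momentsM => //.
    transitivity (\sum_l (y l)^*%C * ((i == j)%:R * (k == l)%:R +
                                      (i == l)%:R * (k == j)%:R)).
      apply: eq_bigr => l _; congr (_ * _).
      rewrite -!natrM !mulnb -(cmean_ZZJJ indepZ ZN); congr cmean.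
      by apply/funext => w; ring.
    under eq_bigr do rewrite mulrDr.
    rewrite big_split /=; congr (_ + _).
      under eq_bigr do rewrite mulrCA.
      by rewrite -mulr_sumr; congr (_ * _); exact: sum_delta.
    under eq_bigr do rewrite mulrA.
    by rewrite -mulr_suml mulrC; congr (_ * _); exact: sum_delta.
  under eq_bigr do rewrite mulrDr !mulrA.
  rewrite big_split /= -!mulr_suml !(sum_delta _ (fun j => (v j)^*%C)).
  by rewrite (mulrC (v k)^*%C).
under eq_fun do rewrite -mulrA.
rewrite cmean_linM; last by do 2 apply: finite_momentsM => //.
rewrite 2!mulr_suml -big_split; apply: eq_bigr => i _ /=.
under eq_fun do rewrite mulrCA.
rewrite cmean_linM; last by do 2 apply: finite_momentsM => //.
rewrite -!mulrA -mulrDr /inner; congr (_ * _).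
rewrite !mulr_sumr -big_split.
by apply: eq_bigr => k _ /=; rewrite key; ring.
Qed.

Lemma cmean_affine2 (p q : R[i]) u v :
  cmean P (fun w => (p + lin u w) * (q + lin v w)^*%C) = p * q^*%C + inner u v.
Proof.
have fml z := finite_moments_lin z.
have fmlJ z := finite_momentsJ (fml z).
have -> : (fun w => (p + lin u w) * (q + lin v w)^*%C) =
    (fun w => (p * q^*%C + q^*%C * lin u w) +
              (p * (lin v w)^*%C + lin u w * (lin v w)^*%C)).
  by apply/funext => w; rewrite rmorphD /=; ring.
have fmc c := @finite_moments_cst _ _ _ P c.
rewrite cmeanD; [|apply: finite_momentsD => //; exact: finite_momentsZ
  |apply: finite_momentsD; [exact: finite_momentsZ|exact: finite_momentsM]].
rewrite cmeanD//; last exact: finite_momentsZ.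
rewrite cmeanD; [|exact: finite_momentsZ|exact: finite_momentsM].
rewrite cmean_cst !cmeanZ// cmean_linJ cmeanJ// !cmean_lin conjc0.
by rewrite !mulr0 addr0 add0r.
Qed.

Lemma cmean_affine4 (p q p' q' : R[i]) u v u' v' :
  cmean P (fun w => (p + lin u w) * (q + lin v w)^*%C *
    ((p' + lin u' w) * (q' + lin v' w)^*%C)^*%C) =
  (p * q^*%C + inner u v) * (p' * q'^*%C + inner u' v')^*%C +
  inner u u' * (q^*%C * q' + inner v' v) + inner v' v * (p * p'^*%C).
Proof.
have fml z := finite_moments_lin z.
have fmlJ z := finite_momentsJ (fml z).
have fm1 := @finite_moments_cst _ _ _ P 1.
(* Four booleans tell which factors contribute their linear form rather than their constant, giving
   sixteen terms with coefficient [cf] and random part [G]. *)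
pose pick (b : bool) (f : T -> R[i]) w := if b then f w else 1.
pose G a b c e w := (pick a (lin u) w * pick b (lin v') w) *
  (pick c (fun w => (lin v w)^*%C) w * pick e (fun w => (lin u' w)^*%C) w).
pose cf a b c e : R[i] := (if a then 1 else p) * (if b then 1 else q') *
  ((if c then 1 else q^*%C) * (if e then 1 else p'^*%C)).
have fmpick b f : finite_moments P f -> finite_moments P (pick b f).
  by case: b.
have fmG a b c e : finite_moments P (G a b c e).
  by apply: finite_momentsM; apply: finite_momentsM; exact: fmpick.
have -> : (fun w => (p + lin u w) * (q + lin v w)^*%C *
    ((p' + lin u' w) * (q' + lin v' w)^*%C)^*%C) =
    (fun w => \sum_a \sum_b \sum_c \sum_e cf a b c e * G a b c e w).
  apply/funext => w; rewrite !big_bool /cf /G /pick.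
  by rewrite !rmorphM !rmorphD /= !conjcK; ring.
have -> : cmean P (fun w => \sum_a \sum_b \sum_c \sum_e cf a b c e * G a b c e w)
    = \sum_a \sum_b \sum_c \sum_e cf a b c e * cmean P (G a b c e).
  rewrite cmean_sum => [|a]; last first.
    do 3 apply: finite_moments_sum => ?; exact: finite_momentsZ.
  apply: eq_bigr => a _; rewrite cmean_sum => [|b]; last first.
    do 2 apply: finite_moments_sum => ?; exact: finite_momentsZ.
  apply: eq_bigr => b _; rewrite cmean_sum => [|c]; last first.
    apply: finite_moments_sum => ?; exact: finite_momentsZ.
  apply: eq_bigr => c _; rewrite cmean_sum => [|e]; last exact: finite_momentsZ.
  by apply: eq_bigr => e _; rewrite cmeanZ.
have JE y z : cmean P (fun w => (lin y w)^*%C * (lin z w)^*%C) = 0.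
  under eq_fun do rewrite -rmorphM.
  by rewrite cmeanJ ?cmean_lin2 ?conjc0//; exact: finite_momentsM.
have J3E x y z : cmean P (fun w => lin x w * ((lin y w)^*%C * (lin z w)^*%C)) = 0.
  have -> : (fun w => lin x w * ((lin y w)^*%C * (lin z w)^*%C)) =
      (fun w => (lin y w * lin z w * (lin x w)^*%C)^*%C).
    by apply/funext => w; rewrite !rmorphM /= conjcK mulrC.
  rewrite cmeanJ ?cmean_lin2J ?conjc0//.
  by apply: finite_momentsM => //; exact: finite_momentsM.
have JlE y : cmean P (fun w => (lin y w)^*%C) = 0.
  by rewrite cmeanJ ?cmean_lin ?conjc0.
have lE y : cmean P (fun w => lin y w) = 0 by exact: cmean_lin.
(* [a], [b] select unconjugated forms and [c], [e] conjugated ones; only the six balanced choices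
   survive. *)
have GE a b c e : cmean P (G a b c e) =
  if [&& a, b, c & e] then inner u v * inner v' u' + inner u u' * inner v' v
  else if [&& a, ~~ b, c & ~~ e] then inner u v
  else if [&& a, ~~ b, ~~ c & e] then inner u u'
  else if [&& ~~ a, b, c & ~~ e] then inner v' v
  else if [&& ~~ a, b, ~~ c & e] then inner v' u'
  else (~~ [|| a, b, c | e])%:R.
  rewrite /G /pick; case: a b c e => [] [] [] [] /=;
    under eq_fun do rewrite ?mulr1 ?mul1r;
    by rewrite ?cmean_lin2J2 ?cmean_lin2J ?cmean_linJ ?J3E ?JE ?cmean_lin2
               ?JlE ?lE ?cmean_cst.
under eq_bigr do under eq_bigr do under eq_bigr do under eq_bigr do rewrite GE.
rewrite !big_bool /cf /=.
have innerJ y z : (inner y z)^*%C = inner z y.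
  rewrite /inner rmorph_sum; apply: eq_bigr => i _.
  by rewrite rmorphM /= conjcK mulrC.
rewrite rmorphD rmorphM /= conjcK innerJ; ring.
Qed.

End LinearForms.

(** * Second moments of weighted sums over columns *)

Section SecondMoment.
Context {d : measure_display} {T : measurableType d} {R : realType}.
Variables (P : probability T R) (I : finType) (Z : I -> T -> R[i]).
Hypothesis indepZ : mutually_independent P (fun i => re_im (Z i)).
Hypothesis ZN : forall i, std_complex_gaussian P (Z i).
Local Open Scope complex_scope.
Variables (M : finType) (c p q : M -> R[i]) (u v : M -> I -> R[i]).
Variables (a b : R[i]).
Hypothesis inner_u : forall m m', inner (u m) (u m') = a * (m == m')%:R.
Hypothesis inner_v : forall m m', inner (v m) (v m') = b * (m == m')%:R.

Lemma finite_moments_affine (x : R[i]) (y : I -> R[i]) :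
  finite_moments P (fun w => x + lin Z y w).
Proof.
by apply: finite_momentsD; [exact: finite_moments_cst|exact: finite_moments_lin].
Qed.

Lemma finite_moments_affine2 (x x' : R[i]) (y y' : I -> R[i]) :
  finite_moments P (fun w => (x + lin Z y w) * (x' + lin Z y' w)^*%C).
Proof.
apply: finite_momentsM; last apply: finite_momentsJ; exact: finite_moments_affine.
Qed.

Lemma cmean_sum_sqr (F : M -> T -> R[i]) : (forall m, finite_moments P (F m)) ->
  cmean P (fun w => (\sum_m c m * F m w) * (\sum_m c m * F m w)^*%C) =
  \sum_m \sum_m' c m * (c m')^*%C * cmean P (fun w => F m w * (F m' w)^*%C).
Proof.
move=> fmF.
have E w : (\sum_m c m * F m w) * (\sum_m c m * F m w)^*%C =
    \sum_m \sum_m' c m * (c m')^*%C * (F m w * (F m' w)^*%C).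
  rewrite rmorph_sum mulr_suml; apply: eq_bigr => m _.
  rewrite mulr_sumr; apply: eq_bigr => m' _.
  by rewrite rmorphM /=; ring.
under eq_fun do rewrite E.
have fmFF m m' : finite_moments P (fun w => F m w * (F m' w)^*%C).
  by apply/finite_momentsM/finite_momentsJ.
rewrite cmean_sum => [|m]; last first.
  by apply: finite_moments_sum => m'; exact: finite_momentsZ.
apply: eq_bigr => m _; rewrite cmean_sum => [|m']; last exact: finite_momentsZ.
by apply: eq_bigr => m' _; rewrite cmeanZ.
Qed.

Lemma cmean_bilinear :
  cmean P (fun w => \sum_m c m * ((p m + lin Z (u m) w) * (q m + lin Z (v m) w)^*%C)) =
  \sum_m c m * (p m * (q m)^*%C + inner (u m) (v m)).
Proof.
have fm m := finite_moments_affine2 (p m) (q m) (u m) (v m).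
rewrite cmean_sum => [|m]; last exact: finite_momentsZ.
by apply: eq_bigr => m _; rewrite cmeanZ// (cmean_affine2 indepZ ZN).
Qed.

Lemma cmean_bilinear_sqr
    (S := fun w => \sum_m c m *
       ((p m + lin Z (u m) w) * (q m + lin Z (v m) w)^*%C)) :
  cmean P (fun w => S w * (S w)^*%C) = cmean P S * (cmean P S)^*%C +
  \sum_m c m * (c m)^*%C *
    (a * (q m * (q m)^*%C + b) + b * (p m * (p m)^*%C)).
Proof.
rewrite /S cmean_sum_sqr => [|m]; last exact: finite_moments_affine2.
rewrite cmean_bilinear rmorph_sum mulr_suml -big_split.
apply: eq_bigr => m _ /=.
under eq_bigr => m' _.
  rewrite (cmean_affine4 indepZ ZN) inner_u inner_v (eq_sym m').
  (* Separates the product of the two means, which sums over all pairs to |E S|^2, from a remainder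
     supported on m = m'. *)
  rewrite (_ : c m * _ * _ = c m * (p m * (q m)^*%C + inner (u m) (v m)) *
     ((c m')^*%C * (p m' * (q m')^*%C + inner (u m') (v m'))^*%C) +
     (c m * (c m')^*%C * (a * ((q m)^*%C * q m' + b * (m == m')%:R)
     + b * (p m * (p m')^*%C))) * (m == m')%:R); last by ring.
  over.
rewrite big_split /= -mulr_sumr sum_delta eqxx mulr1.
congr (_ + _); last by ring.
by congr (_ * _); apply: eq_bigr => m' _; rewrite rmorphM.
Qed.

Lemma cmean_linear_sqr
    (S := fun w => \sum_m c m * (p m + lin Z (u m) w)) :
  cmean P (fun w => S w * (S w)^*%C) =
  (\sum_m c m * p m) * (\sum_m c m * p m)^*%C +
  a * \sum_m c m * (c m)^*%C.
Proof.
rewrite /S cmean_sum_sqr => [|m]; last exact: finite_moments_affine.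
rewrite rmorph_sum mulr_suml mulr_sumr -big_split.
apply: eq_bigr => m _ /=.
under eq_bigr => m' _.
  rewrite (cmean_affine2 indepZ ZN) inner_u.
  rewrite (_ : c m * _ * _ = c m * p m * ((c m')^*%C * (p m')^*%C) +
     (c m * (c m')^*%C * a) * (m == m')%:R); last by ring.
  over.
rewrite big_split /= -mulr_sumr sum_delta.
congr (_ + _); last by ring.
by congr (_ * _); apply: eq_bigr => m' _; rewrite rmorphM.
Qed.

Lemma cmean_sub_sqr (F : T -> R[i]) : finite_moments P F ->
  cmean P (fun w => (F w - cmean P F) * (F w - cmean P F)^*%C) =
  cmean P (fun w => F w * (F w)^*%C) - cmean P F * (cmean P F)^*%C.
Proof.
move=> fmF; set e := cmean P F.
have fmJ := finite_momentsJ fmF.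
have -> : (fun w => (F w - e) * (F w - e)^*%C) = (fun w =>
   (F w * (F w)^*%C + (- e^*%C) * F w) + ((- e) * (F w)^*%C + e * e^*%C)).
  by apply/funext => w; rewrite rmorphB /=; ring.
have fm1 := finite_momentsM fmF fmJ.
have fm2 c' := finite_momentsZ c' fmF.
have fm3 c' := finite_momentsZ c' fmJ.
have fm4 := @finite_moments_cst _ _ _ P (e * e^*%C).
rewrite cmeanD; [|exact: finite_momentsD..].
rewrite (cmeanD fm1 (fm2 _)) (cmeanD (fm3 _) fm4) (cmeanZ _ fmF) (cmeanZ _ fmJ).
rewrite (cmeanJ fmF) cmean_cst -/e; ring.
Qed.

End SecondMoment.

(** * The downlink model *)

Local Open Scope complex_scope.
Local Open Scope sesquilinear_scope.

Lemma adjmxE (R : realType) m n (A : 'M[R[i]]_(m, n)) i j :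
  (A ^t*) i j = (A j i)^*%C.
Proof. by rewrite !mxE. Qed.

Lemma adjmxM (R : realType) m n p (A : 'M[R[i]]_(m, n)) (B : 'M[R[i]]_(n, p)) :
  (A *m B)^t* = B^t* *m A^t*.
Proof. by rewrite trmx_mul map_mxM. Qed.

Lemma mulmx11E (R : comNzRingType) (A B : 'M[R]_1) :
  (A *m B) 0 0 = A 0 0 * B 0 0.
Proof. by rewrite mxE big_ord1. Qed.

Lemma conjcM (R : realType) (x y : R[i]) : (x * y)^*%C = x^*%C * y^*%C.
Proof. exact: rmorphM. Qed.

Lemma conjcD (R : realType) (x y : R[i]) : (x + y)^*%C = x^*%C + y^*%C.
Proof. exact: rmorphD. Qed.

Lemma conjc_sum (R : realType) (I : Type) (r : seq I) (p : pred I)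
    (F : I -> R[i]) :
  (\sum_(i <- r | p i) F i)^*%C = \sum_(i <- r | p i) (F i)^*%C.
Proof. exact: rmorph_sum. Qed.

Lemma expi_unit (R : realType) (t : R) : expi t * (expi t)^*%C = 1.
Proof.
rewrite /expi; apply/eqP; rewrite eq_complex /=; apply/andP; split; apply/eqP.
  by rewrite -!expr2 mulrN opprK -!expr2 cos2Dsin2.
ring.
Qed.

(* Locked, like the definitions built on it, because otherwise the comparison of
   two instances unfolds all matrix products. *)
HB.lock Definition bil {R : realType} {n : nat} (x y : 'rV[R[i]]_n)
  (A : 'M[R[i]]_n) : R[i] := (x *m A *m y^t*) 0 0.

Section Sesquilinear.
Context {R : realType} {n : nat}.
Local Notation C := R[i].
Implicit Types (x y : 'rV[C]_n) (A B : 'M[C]_n).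

Lemma bilE x y A : bil x y A = (x *m A *m y^t*) 0 0.
Proof. by rewrite bil.unlock. Qed.

Lemma bilD x y A B : bil x y (A + B) = bil x y A + bil x y B.
Proof. by rewrite !bilE mulmxDr mulmxDl mxE. Qed.

Lemma bilZ x y c A : bil x y (c *: A) = c * bil x y A.
Proof. by rewrite !bilE -scalemxAr -scalemxAl mxE. Qed.

Lemma bil_scalar x y c : bil x y c%:M = c * bil x y 1%:M.
Proof. by rewrite -[c%:M]scalemx1 bilZ. Qed.

(** The middle matrix has rank one, so the form factors into two scalars; this is how every [Mmat]
    is eliminated. *)
Lemma bil_rank1 x y A B :
  bil x x (A *m (y^t* *m y) *m B) = bil x y A * bil y x B.
Proof. by rewrite !bilE -mulmx11E !mulmxA. Qed.

Lemma bil1E x y : bil x y 1%:M = \sum_i x 0 i * (y 0 i)^*%C.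
Proof. by rewrite !bilE mulmx1 mxE; apply: eq_bigr => i _; rewrite adjmxE. Qed.

Lemma bil1J x y : (bil x y 1%:M)^*%C = bil y x 1%:M.
Proof.
rewrite !bil1E conjc_sum; apply: eq_bigr => i _.
by rewrite conjcM conjcK mulrC.
Qed.

Lemma bil_gram m x y (H : 'M[C]_(n, m)) : bil x y (H *m H^t*) =
  \sum_t (x *m H) 0 t * ((y *m H) 0 t)^*%C.
Proof.
rewrite !bilE mulmxA -mulmxA -adjmxM mxE.
by apply: eq_bigr => t _; rewrite adjmxE.
Qed.

Lemma tr_rank1 y : \tr (y^t* *m y) = bil y y 1%:M.
Proof. by rewrite mxtrace_mulC /mxtrace big_ord1 !bilE mulmx1. Qed.

Lemma tr_gram_rank1 m y (H : 'M[C]_(n, m)) :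
  \tr (H^t* *m (y^t* *m y) *m H) = bil y y (H *m H^t*).
Proof.
rewrite mulmxA -adjmxM -mulmxA mxtrace_mulC /mxtrace big_ord1.
by rewrite !bilE adjmxM !mulmxA.
Qed.

End Sesquilinear.

HB.lock Definition ris_row {R : realType} {sys : system R} (k : 'I_Kf) :
  'rV[R[i]]_nris := (h_ris k) ^t* *m Theta.

(** * Deterministic identities for the channel rows *)

Section Model.
Context {R : realType} {sys : system R}.
Local Notation C := R[i].

Lemma ris_rowE k : ris_row k = (h_ris k)^t* *m Theta.
Proof. by rewrite ris_row.unlock. Qed.

Lemma adj_ris_row j : (ris_row j)^t* = Theta^t* *m h_ris j.
Proof. by rewrite !ris_rowE adjmxM trmxCK. Qed.

Lemma quadE k A : quad k A = bil (ris_row k) (ris_row k) A.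
Proof. by rewrite bilE adj_ris_row ris_rowE mulmxA. Qed.

Lemma MmatE j : Mmat j = (ris_row j)^t* *m ris_row j.
Proof. by rewrite /Mmat adj_ris_row !ris_rowE !mulmxA. Qed.

Lemma beta2J : (beta2 : C)^*%C = beta2.
Proof. exact: conjc_real. Qed.

Lemma beta2_sqrJ : (beta2 ^+ 2 : C)^*%C = beta2 ^+ 2.
Proof. by rewrite expr2 conjcM beta2J. Qed.

Lemma alpha2J : (alpha2 : C)^*%C = alpha2.
Proof. exact: conjc_real. Qed.

Lemma steering_unit n1 n2 (delta az el : R) i :
  steering n1 n2 delta az el i 0 * (steering n1 n2 delta az el i 0)^*%C = 1 :> C.
Proof.
case: (mxtens.mxtens_indexP i) => i1 i2.
pose A : 'cV[C]_n1 :=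
  \col_(m < n1) expi (2 * pi * m%:R * delta * cos el * sin az / @wavelength R sys).
pose B : 'cV[C]_n2 :=
  \col_(m < n2) expi (2 * pi * m%:R * delta * sin el / @wavelength R sys).
have E : steering n1 n2 delta az el (mxtens.mxtens_index (i1, i2)) 0 =
    A i1 0 * B i2 0.
  rewrite -mxtens.tensmxE /steering; congr (mxtens.tensmx _ _ _ _).
  (* The column indices [mxtens_index (0, 0)] and [0] of a width 1 * 1 agree as natural numbers. *)
  exact: val_inj.
by rewrite E !mxE rmorphM /= mulrACA !expi_unit mulr1.
Qed.

(** The phases and the steering entries are unimodular, so each of the N entries of the row has
    squared modulus [varsigma k]. *)
Lemma bil1_varsigma k : bil (ris_row k) (ris_row k) 1%:M = (varsigma k)%:C * nris%:R.
Proof.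
rewrite bil1E.
have E n : ris_row k 0 n * (ris_row k 0 n)^*%C = (varsigma k)%:C.
  rewrite !ris_rowE /Theta mul_mx_diag mxE adjmxE /h_ris mxE.
  have -> : (\row_m expi (theta m)) 0 n = expi (theta n) :> C by rewrite mxE.
  set x := b_N _ _ n 0.
  have xx : x * x^*%C = 1 by exact: steering_unit.
  have ss : (Num.sqrt (varsigma k))%:C * (Num.sqrt (varsigma k))%:C =
      (varsigma k)%:C :> C.
    by rewrite -rmorphM -expr2 sqr_sqrtr// ltW// varsigma_gt0.
  have sJ : (Num.sqrt (varsigma k))%:C^*%C = (Num.sqrt (varsigma k))%:C :> C.
    exact: conjc_real.
  have ee := expi_unit (theta n).
  move: sJ ss; set r := (Num.sqrt _)%:C; move: r => r rJ <-.
  move: (expi (theta n)) ee => e ee; rewrite !rmorphM /= !conjcK rJ.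
  transitivity (r * r * (x * x^*%C) * (e * e^*%C)); first by ring.
  by rewrite xx ee !mulr1.
under eq_bigr do rewrite E.
by rewrite sumr_const card_ord mulr_natr.
Qed.

(** [H2bar] is b a^H with unimodular entries in a, so every column of the subarray contributes the
    same squared modulus |h_k^H Theta b|^2. *)
Lemma bil_HH_b k s :
  bil (ris_row k) (ris_row k) (HHbar s) = Mstar%:R * (b_ris^t* *m Mmat k *m b_ris) 0 0.
Proof.
have -> : (b_ris^t* *m Mmat k *m b_ris) 0 0 =
    (ris_row k *m b_ris) 0 0 * ((ris_row k *m b_ris) 0 0)^*%C.
  by rewrite MmatE mulmxA -adjmxM -mulmxA mulmx11E adjmxE mulrC.
rewrite /HHbar bil_gram; set y := (ris_row k *m b_ris) 0 0.
have E t : (ris_row k *m H2bar_ s) 0 t * ((ris_row k *m H2bar_ s) 0 t)^*%C = y * y^*%C.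
  have -> : (ris_row k *m H2bar_ s) 0 t = y * (a_M (antenna s t) 0)^*%C.
    have -> : (ris_row k *m H2bar_ s) 0 t = (ris_row k *m H2bar) 0 (antenna s t).
      by rewrite !mxE; apply: eq_bigr => n _; rewrite /H2bar_ /columns !mxE.
    by rewrite /H2bar mulmxA mxE big_ord1 adjmxE.
  have aa : a_M (antenna s t) 0 * (a_M (antenna s t) 0)^*%C = 1.
    exact: steering_unit.
  move: (a_M _ _) aa => e ee; move: y => y; rewrite rmorphM /= conjcK.
  by transitivity (y * y^*%C * (e * e^*%C)); [ring|rewrite ee mulr1].
under eq_bigr do rewrite E.
by rewrite sumr_const card_ord mulr_natl.
Qed.

Lemma antenna_inj s s' t t' : antenna s t = antenna s' t' -> (s, t) = (s', t').
Proof.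
by move=> /cast_ord_inj /(can_inj (@mxtens.mxtens_indexK _ _)).
Qed.

End Model.

(** Covariance of the scattered parts seen by users [k] and [j] at one antenna, the same for every
    antenna. *)
HB.lock Definition scatter_corr {R : realType} {sys : system R} (k j : 'I_Kf) : R[i] :=
  beta2 ^+ 2 * bil (ris_row k) (ris_row j) 1%:M.

(* E[gtilde_sk^H gtilde_sj]. *)
HB.lock Definition mean_gain {R : realType} {sys : system R} (k j : 'I_Kf)
  (s : 'I_nsub) : R[i] := bil (ris_row k) (ris_row j) (meanHH s).

(** * Mean and second moment of the far-field gains *)

Section Moments.
Context {R : realType} {sys : system R}.
Context {d : measure_display} {T : measurableType d}.
Variables (P : probability T R) (H2tilde : T -> 'M[R[i]]_(nris, nant)).
Hypothesis H2tilde_iid : iid_CN01 P H2tilde.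
Local Notation C := R[i].

Let Z (nm : 'I_nris * 'I_nant) (w : T) : C := H2tilde w nm.1 nm.2.

Let indepZ : mutually_independent P (fun nm => re_im (Z nm)).
Proof. by case: H2tilde_iid. Qed.

Let ZN nm : std_complex_gaussian P (Z nm).
Proof. by have [_ h] := H2tilde_iid; exact: h. Qed.

(* The entry of h_k^H Theta H_{2,s} in column t, for m = (s, t), is los k m plus
   the linear form with coefficients nlos k m in the entries of H2tilde. *)
Definition los (k : 'I_Kf) (m : 'I_nsub * 'I_Mstar) : C :=
  alpha2 * (ris_row k *m H2bar_ m.1) 0 m.2.

Definition nlos (k : 'I_Kf) (m : 'I_nsub * 'I_Mstar)
  (nm : 'I_nris * 'I_nant) : C :=
  beta2 * ris_row k 0 nm.1 * (antenna m.1 m.2 == nm.2)%:R.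

Lemma scatter_corrE k j :
  scatter_corr k j = beta2 ^+ 2 * bil (ris_row k) (ris_row j) 1%:M.
Proof. by rewrite scatter_corr.unlock. Qed.

Lemma gtildeHE s k w t :
  gtildeH H2tilde s k w 0 t = los k (s, t) + lin Z (nlos k (s, t)) w.
Proof.
rewrite /gtildeH -ris_rowE !mxE /los mxE mulr_sumr.
rewrite /lin -(pair_bigA _ (fun n a => nlos k (s, t) (n, a) * Z (n, a) w)) /=.
rewrite -big_split; apply: eq_bigr => n _ /=.
rewrite (_ : \sum_a _ = beta2 * ris_row k 0 n * H2tilde w n (antenna s t)).
  rewrite /H2bar_ /columns /H2 !mxE; ring.
rewrite /nlos /Z /=.
under eq_bigr do rewrite mulrAC.
exact: (sum_delta (antenna s t) (fun a => beta2 * ris_row k 0 n * H2tilde w n a)).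
Qed.

(** Distinct pairs (s, t) name distinct antennas, whose forms involve disjoint columns of
    [H2tilde]. *)
Lemma inner_nlos k j m m' :
  inner (nlos k m) (nlos j m') = scatter_corr k j * (m == m')%:R.
Proof.
rewrite /inner -(pair_bigA _ (fun n a => nlos k m (n, a) * (nlos j m' (n, a))^*%C)) /=.
rewrite !scatter_corrE bil1E mulr_sumr mulr_suml; apply: eq_bigr => n _.
rewrite /nlos /=.
transitivity (\sum_a (beta2 ^+ 2 * (ris_row k 0 n * (ris_row j 0 n)^*%C) *
    (antenna m'.1 m'.2 == a)%:R) * (antenna m.1 m.2 == a)%:R).
  apply: eq_bigr => a _; rewrite !conjcM beta2J conjc_nat; ring.
rewrite sum_delta; congr (_ * (nat_of_bool _)%:R).
case: m m' => [s t] [s' t'] /=.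
apply/idP/idP => /eqP.
  by move=> /antenna_inj ->.
by case=> -> ->.
Qed.

(** Converts the single sum over columns used by the moment lemmas into the nested sum over visible
    subarrays. *)
Lemma sum_vr (V : {set 'I_nsub}) (e : 'I_nsub -> C)
    (F : 'I_nsub * 'I_Mstar -> C) :
  \sum_m (if m.1 \in V then e m.1 else 0) * F m =
  \sum_(s in V) e s * \sum_t F (s, t).
Proof.
transitivity (\sum_m (if m.1 \in V then e m.1 else 0) * F (m.1, m.2)).
  by apply: eq_bigr => -[].
rewrite -(pair_bigA _ (fun s t => (if s \in V then e s else 0) * F (s, t))) /=.
rewrite [RHS]big_mkcond; apply: eq_bigr => s _; rewrite -mulr_sumr.
by case: ifP => // _; rewrite mul0r.
Qed.

Lemma sum_los k j s : \sum_t los k (s, t) * (los j (s, t))^*%C =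
  alpha2 ^+ 2 * bil (ris_row k) (ris_row j) (HHbar s).
Proof.
rewrite /HHbar bil_gram mulr_sumr; apply: eq_bigr => t _.
by rewrite /los conjcM alpha2J; ring.
Qed.

Lemma mean_gainE k j s : mean_gain k j s =
  \sum_t (los k (s, t) * (los j (s, t))^*%C + scatter_corr k j).
Proof.
rewrite big_split /= sum_los sumr_const card_ord -mulr_natl.
by rewrite mean_gain.unlock /meanHH bilD bilZ bil_scalar !scatter_corrE; ring.
Qed.

Lemma scatter_corrJ k j : (scatter_corr k j)^*%C = scatter_corr j k.
Proof.
by rewrite !scatter_corrE conjcM beta2_sqrJ bil1J.
Qed.

Lemma mean_gainJ k j s : (mean_gain k j s)^*%C = mean_gain j k s.
Proof.
rewrite !mean_gainE conjc_sum; apply: eq_bigr => t _.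
by rewrite conjcD conjcM conjcK scatter_corrJ mulrC.
Qed.

Definition weight (j : 'I_Kf) (m : 'I_nsub * 'I_Mstar) : C :=
  if m.1 \in vr_far j then (Num.sqrt (eta_far m.1 j))%:C else 0.

Definition combined (k j : 'I_Kf) (w : T) : C := \sum_(s in vr_far j)
  (Num.sqrt (eta_far s j))%:C * (gtildeH H2tilde s k w *m gtilde H2tilde s j w) 0 0.

Lemma combinedE k j : combined k j = fun w => \sum_m weight j m *
  ((los k m + lin Z (nlos k m) w) * (los j m + lin Z (nlos j m) w)^*%C).
Proof.
apply/funext => w; rewrite (sum_vr _ (fun s => (Num.sqrt (eta_far s j))%:C)).
apply: eq_bigr => s _; congr (_ * _); rewrite mxE; apply: eq_bigr => t _.
have -> : gtilde H2tilde s j w t 0 = (gtildeH H2tilde s j w 0 t)^*%C.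
  exact: adjmxE.
exact: (congr2 (fun x y => x * y^*%C) (gtildeHE s k w t) (gtildeHE s j w t)).
Qed.

Lemma cmean_combined k j : cmean P (combined k j) =
  \sum_(s in vr_far j) (Num.sqrt (eta_far s j))%:C * mean_gain k j s.
Proof.
rewrite combinedE.
rewrite (cmean_bilinear indepZ ZN).
rewrite (sum_vr _ (fun s => (Num.sqrt (eta_far s j))%:C)).
apply: eq_bigr => s _; congr (_ * _); rewrite mean_gainE; apply: eq_bigr => t _.
by rewrite inner_nlos eqxx mulr1.
Qed.

Lemma cmean_combined_sqr k j :
  cmean P (fun w => combined k j w * (combined k j w)^*%C) =
  cmean P (combined k j) * (cmean P (combined k j))^*%C +
  \sum_(s in vr_far j) (eta_far s j)%:C *
    (scatter_corr k k * (alpha2 ^+ 2 * bil (ris_row j) (ris_row j) (HHbar s)) +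
     scatter_corr j j * (alpha2 ^+ 2 * bil (ris_row k) (ris_row k) (HHbar s)) +
     Mstar%:R * (scatter_corr k k * scatter_corr j j)).
Proof.
rewrite combinedE.
rewrite (cmean_bilinear_sqr indepZ ZN _ _ _ (inner_nlos k k) (inner_nlos j j)).
congr (_ + _).
have E m : weight j m * (weight j m)^*%C =
    if m.1 \in vr_far j then (eta_far m.1 j)%:C else 0.
  rewrite /weight; case: ifP => _; last by rewrite mul0r.
  by rewrite conjc_real -rmorphM -expr2 sqr_sqrtr// eta_far_ge0.
under eq_bigr do rewrite E.
rewrite (sum_vr _ (fun s => (eta_far s j)%:C)).
apply: eq_bigr => s _; congr (_ * _).
rewrite big_split /= -!mulr_sumr sum_los big_split /= sum_los.
have -> : \sum_(t < Mstar) scatter_corr j j = Mstar%:R * scatter_corr j j.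
  by rewrite sumr_const card_ord [RHS]mulr_natl.
ring.
Qed.

Lemma finite_moments_combined k j : finite_moments P (combined k j).
Proof.
rewrite combinedE.
apply: finite_moments_sum => m; apply: finite_momentsZ.
exact: finite_moments_affine2.
Qed.

End Moments.

Lemma Re_sum (R : realType) (I : Type) (r : seq I) (p : pred I) (F : I -> R[i]) :
  complex.Re (\sum_(i <- r | p i) F i) = \sum_(i <- r | p i) complex.Re (F i).
Proof.
elim/big_rec2: _ => [//|i x y _ <-].
by case: (F i) y => ? ? [].
Qed.

Lemma Re_realM (R : realType) (x : R) (z : R[i]) :
  complex.Re (x%:C * z) = x * complex.Re z.
Proof. by case: z => a b /=; rewrite mul0r subr0. Qed.

Lemma sum_sqr_expand (R : realType) (I : finType) (V : {set I}) (e : I -> R)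
    (kappa D : I -> R[i]) :
  \sum_(s in V) \sum_(s' in V) (e s)%:C * (e s')%:C *
    (kappa s * (kappa s')^*%C + (s == s')%:R * D s) =
  (\sum_(s in V) (e s)%:C * kappa s) * (\sum_(s in V) (e s)%:C * kappa s)^*%C +
  \sum_(s in V) (e s ^+ 2)%:C * D s.
Proof.
rewrite conjc_sum mulr_suml -big_split; apply: eq_bigr => s sV /=.
rewrite mulr_sumr.
under eq_bigr do rewrite mulrDr.
rewrite big_split /=; congr (_ + _).
  by apply: eq_bigr => s' _; rewrite conjcM conjc_real; ring.
rewrite (bigD1 s)//= eqxx big1 ?addr0 => [|s' /andP[_ s's]].
  by rewrite rmorphXn expr2 mul1r.
by rewrite eq_sym (negbTE s's) mul0r mulr0.
Qed.

(** Matches the double sums over s, s' of the theorem with a squared mean plus a variance; the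
    weights are real, so real parts pass through them. *)
Lemma Re_sum_sqr_expand (R : realType) (I : finType) (V : {set I})
    (eta : I -> R) (X : I -> I -> R[i]) (kappa D : I -> R[i]) :
  (forall s, 0 <= eta s) ->
  (forall s s', X s s' = kappa s * (kappa s')^*%C + (s == s')%:R * D s) ->
  \sum_(s in V) \sum_(s' in V) Num.sqrt (eta s * eta s') * complex.Re (X s s') =
  complex.Re ((\sum_(s in V) (Num.sqrt (eta s))%:C * kappa s) *
    (\sum_(s in V) (Num.sqrt (eta s))%:C * kappa s)^*%C +
  \sum_(s in V) (eta s)%:C * D s).
Proof.
move=> eta0 XE.
under [X in complex.Re (_ + X)]eq_bigr => s _.
  rewrite -(sqr_sqrtr (eta0 s)).
  over.
rewrite -(sum_sqr_expand V (fun s => Num.sqrt (eta s))) Re_sum.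
apply: eq_bigr => s _; rewrite Re_sum; apply: eq_bigr => s' _.
by rewrite sqrtrM// XE -rmorphM Re_realM.
Qed.

Lemma mean_sqr_modulus {d : measure_display} {T : measurableType d}
    {R : realType} (P : probability T R) (c : R) (F : T -> R[i]) :
  0 <= c -> finite_moments P F ->
  mean P (fun w => modulus ((Num.sqrt c)%:C * F w) ^+ 2) =
  c * complex.Re (cmean P (fun w => F w * (F w)^*%C)).
Proof.
move=> c0 fmF.
rewrite -Re_realM -cmeanZ; last by apply/finite_momentsM/finite_momentsJ.
have -> : (fun w => c%:C * (F w * (F w)^*%C)) =
    (fun w => (modulus ((Num.sqrt c)%:C * F w) ^+ 2)%:C).
  apply/funext => w; rewrite sqr_modulus conjcM conjc_real.
  rewrite -[in LHS](sqr_sqrtr c0) expr2 rmorphM /=; ring.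
by rewrite cmean_real.
Qed.

(** The four summands containing [M] multiply out of a product of two means; the other three, with
    [t] and [t'] standing for the traces, form the variance. *)
Lemma bil_second_moment {R : realType} {n : nat} (x y : 'rV[R[i]]_n)
    (A M : 'M[R[i]]_n) (a b m t t' : R[i]) :
  M = y^t* *m y ->
  bil x x (a ^+ 4 *: (A *m M *m A) + b ^+ 2 *:
    ((a ^+ 2 * m) *: (A *m M) + (a ^+ 2 * t) *: A + (a ^+ 2 * t')%:M
     + (a ^+ 2 * m) *: (M *m A) + (b ^+ 2 * m ^+ 2) *: M
     + (b ^+ 2 * m * t)%:M)) =
  (a ^+ 2 * bil x y A + b ^+ 2 * m * bil x y 1%:M) *
  (a ^+ 2 * bil y x A + b ^+ 2 * m * bil y x 1%:M) +
  (b ^+ 2 * bil x x 1%:M * (a ^+ 2 * t') + b ^+ 2 * t * (a ^+ 2 * bil x x A) +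
   m * (b ^+ 2 * bil x x 1%:M * (b ^+ 2 * t))).
Proof.
move=> ME.
have M1 : bil x x (A *m M) = bil x y A * bil y x 1%:M.
  by rewrite -bil_rank1 mulmx1 ME.
have M2 : bil x x (M *m A) = bil x y 1%:M * bil y x A.
  by rewrite -bil_rank1 mul1mx ME.
have M3 : bil x x M = bil x y 1%:M * bil y x 1%:M.
  by rewrite -bil_rank1 mulmx1 mul1mx ME.
have M4 : bil x x (A *m M *m A) = bil x y A * bil y x A.
  by rewrite -bil_rank1 ME.
rewrite !(bilD, bilZ) M1 M2 M3 M4.
rewrite (bil_scalar _ _ (a ^+ 2 * _)) (bil_scalar _ _ (b ^+ 2 * _ * _)).
ring.
Qed.

Lemma hermitian_rank1 {R : realType} {n m : nat} (x : 'rV[R[i]]_n)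
    (H H' : 'M[R[i]]_(n, m)) (g g' : 'cV[R[i]]_m) :
  (g'^t* *m (H'^t* *m (x^t* *m x) *m H) *m g) 0 0 =
  (x *m H *m g) 0 0 * ((x *m H' *m g') 0 0)^*%C.
Proof.
have -> : g'^t* *m (H'^t* *m (x^t* *m x) *m H) *m g =
    (x *m H' *m g')^t* *m (x *m H *m g) by rewrite !adjmxM !mulmxA.
by rewrite mulmx11E adjmxE mulrC.
Qed.

Lemma hermitian_norm {R : realType} {m : nat} (g : 'cV[R[i]]_m) :
  (g^t* *m g) 0 0 = \sum_t g t 0 * (g t 0)^*%C.
Proof. by rewrite mxE; apply: eq_bigr => t _; rewrite adjmxE mulrC. Qed.

(** * Identification of each term of the SINR *)

Section Terms.
Context {R : realType} {sys : system R}.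
Context {d : measure_display} {T : measurableType d}.
Variables (P : probability T R) (H2tilde : T -> 'M[R[i]]_(nris, nant)).
Hypothesis H2tilde_iid : iid_CN01 P H2tilde.
Local Notation C := R[i].
Local Notation combined := (combined H2tilde).

(* The variance of gtilde_sk^H gtilde_sj. *)
Definition gain_variance (k j : 'I_Kf) (s : 'I_nsub) : C :=
  scatter_corr k k * (alpha2 ^+ 2 * bil (ris_row j) (ris_row j) (HHbar s)) +
  scatter_corr j j * (alpha2 ^+ 2 * bil (ris_row k) (ris_row k) (HHbar s)) +
  Mstar%:R * (scatter_corr k k * scatter_corr j j).

Lemma mean_gain_HHbar k j s : mean_gain k j s =
  alpha2 ^+ 2 * bil (ris_row k) (ris_row j) (HHbar s) +
  beta2 ^+ 2 * Mstar%:R * bil (ris_row k) (ris_row j) 1%:M.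
Proof. by rewrite mean_gain.unlock /meanHH bilD bilZ bil_scalar. Qed.

Lemma bil_Mmat k j A B : bil (ris_row k) (ris_row k) (A *m Mmat j *m B) =
  bil (ris_row k) (ris_row j) A * bil (ris_row j) (ris_row k) B.
Proof. by rewrite MmatE bil_rank1. Qed.

Lemma quad_Cmat k j s : quad k (Cmat s j) =
  mean_gain k j s * mean_gain j k s + gain_variance k j s.
Proof.
have t1 : \tr (Mmat j) = bil (ris_row j) (ris_row j) 1%:M by rewrite MmatE tr_rank1.
have t2 : \tr ((H2bar_ s)^t* *m Mmat j *m H2bar_ s) =
    bil (ris_row j) (ris_row j) (HHbar s) by rewrite MmatE tr_gram_rank1.
rewrite quadE /Cmat t1 t2 !mean_gain_HHbar /gain_variance !scatter_corrE.
exact: bil_second_moment (MmatE j).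
Qed.

Lemma b_coefE k j s s' : b_coef k j s s' =
  complex.Re (mean_gain k j s * (mean_gain k j s')^*%C +
              (s == s')%:R * gain_variance k j s).
Proof.
rewrite /b_coef quadE bilD !bilZ mean_gainJ /kron; congr complex.Re.
have [<-|ss'] := eqVneq s s'.
  by rewrite subrr mul0r addr0 !mul1r -quadE quad_Cmat.
rewrite !mul0r subr0 mul1r addr0 add0r /Dmat bil_Mmat.
by rewrite !mean_gain.unlock.
Qed.

(** For j = k the two cross terms of the variance are equal, but [a_coef] writes one through [HHbar]
    and the other through [b_ris]; [bil_HH_b] and [bil1_varsigma] reconcile them. *)
Lemma a_coefE k s : a_coef k s = complex.Re (gain_variance k k s).
Proof.
rewrite /a_coef quadE bilD bilZ bil_scalar; congr complex.Re.
have hb := bil_HH_b k s; have h1 := bil1_varsigma k.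
rewrite /gain_variance !scatter_corrE h1 hb.
(* Generalizing the scalars presents [ring] with plain variables instead of matrix expressions. *)
move: (_ 0 0) (varsigma k)%:C => x v.
move: alpha2 beta2 (Mstar%:R) (nris%:R) => *.
ring.
Qed.

Lemma PsiE k s : Psi k s = mean_gain k k s.
Proof. by rewrite /Psi quadE mean_gain.unlock. Qed.

Lemma mean_UIF k j :
  mean P (fun w => modulus (UIF H2tilde (mrt_far H2tilde) k j w) ^+ 2) =
  Pf * \sum_(s in vr_far j) \sum_(s' in vr_far j)
    Num.sqrt (eta_far s j * eta_far s' j) * b_coef k j s s'.
Proof.
have fm := finite_moments_combined H2tilde_iid k j.
have := mean_sqr_modulus (ltW Pf_gt0) fm.
rewrite (cmean_combined_sqr H2tilde_iid) (cmean_combined H2tilde_iid).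
move=> ->; congr (_ * _).
apply: (etrans (esym (@Re_sum_sqr_expand R _ (vr_far j) (fun s => eta_far s j)
  (fun s s' => mean_gain k j s * (mean_gain k j s')^*%C +
               (s == s')%:R * gain_variance k j s)
  (mean_gain k j) (gain_variance k j) (fun s => eta_far_ge0 s j) (fun _ _ => erefl)))).
by apply: eq_bigr => s _; apply: eq_bigr => s' _; rewrite b_coefE.
Qed.

Lemma mean_BU k :
  mean P (fun w => modulus (BU P H2tilde (mrt_far H2tilde) k w) ^+ 2) =
  Pf * \sum_(s in vr_far k) eta_far s k * a_coef k s.
Proof.
have fm := finite_moments_combined H2tilde_iid k k.
have fmB : finite_moments P
    (fun w => combined k k w - cmean P (combined k k)).
  by apply: finite_momentsD => //; exact: finite_moments_cst.
have := mean_sqr_modulus (ltW Pf_gt0) fmB.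
rewrite (cmean_sub_sqr fm) (cmean_combined_sqr H2tilde_iid) addrAC subrr add0r.
move=> ->; congr (_ * _); rewrite Re_sum; apply: eq_bigr => s _.
by rewrite Re_realM a_coefE.
Qed.

(** A plain square can replace the squared modulus because [mean_gain k k s] equals its own
    conjugate. *)
Lemma sqr_DS k :
  (modulus (DS P H2tilde (mrt_far H2tilde) k) ^+ 2)%:C =
  Pf%:C * (\sum_(s in vr_far k) (Num.sqrt (eta_far s k))%:C * Psi k s) ^+ 2.
Proof.
have -> : DS P H2tilde (mrt_far H2tilde) k =
    (Num.sqrt Pf)%:C * cmean P (combined k k) by [].
rewrite sqr_modulus (cmean_combined H2tilde_iid) conjcM conjc_real.
rewrite conjc_sum.
under [X in _ * (_ * X)]eq_bigr do rewrite conjcM conjc_real mean_gainJ.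
under [X in _ = _ * X ^+ 2]eq_bigr do rewrite PsiE.
have sP : (Num.sqrt Pf)%:C * (Num.sqrt Pf)%:C = Pf%:C :> C.
  by rewrite -rmorphM -expr2 sqr_sqrtr// ltW// Pf_gt0.
by rewrite mulrACA sP -expr2.
Qed.

Let Z (nm : 'I_nris * 'I_nant) (w : T) : C := H2tilde w nm.1 nm.2.

Let indepZ : mutually_independent P (fun nm => re_im (Z nm)).
Proof. by case: H2tilde_iid. Qed.

Let ZN nm : std_complex_gaussian P (Z nm).
Proof. by have [_ h] := H2tilde_iid; exact: h. Qed.

Definition near_los (k : 'I_Kf) (i : 'I_Kn) (s : 'I_nsub) : C :=
  \sum_t gbar s i t 0 * los k (s, t).

Lemma near_losE k i s :
  near_los k i s = alpha2 * (ris_row k *m H2bar_ s *m gbar s i) 0 0.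
Proof.
rewrite mxE mulr_sumr; apply: eq_bigr => t _.
by rewrite /los mulrC mulrA.
Qed.

Lemma XiE k i s s' : Xi k i s s' = complex.Re
  (near_los k i s * (near_los k i s')^*%C +
   (s == s')%:R * (scatter_corr k k * \sum_t gbar s i t 0 * (gbar s i t 0)^*%C)).
Proof.
rewrite /Xi /Bmat mulmxDr mulmxDl [X in complex.Re X]mxE; congr (complex.Re (_ + _)).
  rewrite -scalemxAr -scalemxAl mxE MmatE hermitian_rank1 !near_losE.
  by rewrite conjcM alpha2J; ring.
rewrite mul_mx_scalar -scalemxAl mxE /kron.
have [<-|ss'] := eqVneq s s'; last by rewrite !mul0r.
rewrite hermitian_norm scatter_corrE bil1_varsigma.
move: (\sum_t _) (varsigma k)%:C beta2 (nris%:R) => *.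
ring.
Qed.

(** The near-field precoder is deterministic, so the interference is a single affine form and its
    covariance is enough, without Wick's formula. *)
Lemma mean_UIN k i :
  mean P (fun w => modulus (UIN H2tilde mrt_near k i w) ^+ 2) =
  Pn * \sum_(s in vr_near i) \sum_(s' in vr_near i)
    Num.sqrt (eta_near s i * eta_near s' i) * Xi k i s s'.
Proof.
pose c (m : 'I_nsub * 'I_Mstar) : C := (if m.1 \in vr_near i
  then (Num.sqrt (eta_near m.1 i))%:C else 0) * gbar m.1 i m.2 0.
pose F w : C := \sum_(s in vr_near i) (Num.sqrt (eta_near s i))%:C *
  (gtildeH H2tilde s k w *m mrt_near s i w) 0 0.
have FE : F = fun w => \sum_m c m * (los k m + lin Z (nlos k m) w).
  apply/funext => w; under [RHS]eq_bigr do rewrite /c -mulrA.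
  rewrite (sum_vr _ (fun s => (Num.sqrt (eta_near s i))%:C)).
  apply: eq_bigr => s _; congr (_ * _); rewrite mxE; apply: eq_bigr => t _.
  rewrite mulrC; congr (_ * _); exact: gtildeHE.
have fm : finite_moments P F.
  rewrite FE; apply: finite_moments_sum => m; apply: finite_momentsZ.
  exact: finite_moments_affine.
have := mean_sqr_modulus (ltW (@Pn_gt0 R sys)) fm.
rewrite {2 3}FE (cmean_linear_sqr indepZ ZN _ _ (inner_nlos k k)) => h.
apply: (etrans h); congr (_ * _).
have E1 : \sum_m c m * los k m =
    \sum_(s in vr_near i) (Num.sqrt (eta_near s i))%:C * near_los k i s.
  under eq_bigr do rewrite /c -mulrA.
  exact: (sum_vr _ (fun s => (Num.sqrt (eta_near s i))%:C)).
have E2 : scatter_corr k k * \sum_m c m * (c m)^*%C =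
    \sum_(s in vr_near i) (eta_near s i)%:C *
      (scatter_corr k k * \sum_t gbar s i t 0 * (gbar s i t 0)^*%C).
  under [RHS]eq_bigr do rewrite mulrCA.
  rewrite -mulr_sumr; congr (_ * _).
  rewrite -(sum_vr _ (fun s => (eta_near s i)%:C)
     (fun m => gbar m.1 i m.2 0 * (gbar m.1 i m.2 0)^*%C)).
  apply: eq_bigr => m _; rewrite /c conjcM mulrACA; congr (_ * _).
  case: ifP => _; last by rewrite mul0r.
  by rewrite conjc_real -rmorphM -expr2 sqr_sqrtr// eta_near_ge0.
rewrite E1 E2.
apply: (etrans (esym (@Re_sum_sqr_expand R _ (vr_near i) (fun s => eta_near s i)
  _ (near_los k i)
  (fun s => scatter_corr k k * \sum_t gbar s i t 0 * (gbar s i t 0)^*%C)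
  (fun s => eta_near_ge0 s i) (fun _ _ => erefl)))).
by apply: eq_bigr => s _; apply: eq_bigr => s' _; rewrite XiE.
Qed.

End Terms.

Theorem proposition2 (R : realType) (sys : system R)
    (d : measure_display) (T : measurableType d) (P : probability T R)
    (H2tilde : T -> 'M[R[i]]_(nris, nant)) (H2tilde_iid : iid_CN01 P H2tilde)
    (k : 'I_Kf) :
  let sinr := SINR P H2tilde mrt_near (mrt_far H2tilde) k in
  SE P H2tilde mrt_near (mrt_far H2tilde) k = log2 (1 + sinr) /\
  sinr%:C =
    Pf%:C * (\sum_(s in vr_far k) (Num.sqrt (eta_far s k))%:C * Psi k s) ^+ 2
    / (Delta k + noise k)%:C.
Proof.
split; first by [].
(* The embedding of [R] into [R[i]] is a field morphism: once the numerators agree, only the real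
   denominators remain to be compared. *)
rewrite -(sqr_DS H2tilde_iid) -fmorph_div /SINR; congr (_ / _)%:C.
congr (_ + _); rewrite (mean_BU H2tilde_iid) /Delta !mulr_sumr.
congr (_ + _ + _); apply: eq_bigr => i _.
  by rewrite (mean_UIF H2tilde_iid).
by rewrite (mean_UIN H2tilde_iid).
Qed.
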